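(* If $K$ is an intersection body in $\mathbb{R}^n$, $n\ge 3$, then $$\mathrm{as}(K) \le \frac{|B_2^{n-1}|}{|B_2^{n-2}|\,|B_2^n|^{\frac1n}}\ \max_{\xi\in S^{n-1}} \mathrm{as}(K\cap \xi^\perp)\ |K|^{\frac1n},$$ with equality when $K=B_2^n$.
   Context: $|\cdot|$ denotes volume (Lebesgue measure, or surface measure for spheres) of the appropriate dimension; $B_2^n$ is the unit Euclidean ball in $\mathbb{R}^n$; $S^{n-1}$ is the unit Euclidean sphere; for $\xi\in S^{n-1}$, $\xi^\perp$ is the central hyperplane perpendicular to $\xi$. For a star body $K$ in $\mathbb{R}^n$, $\mathrm{as}(K)=\frac{1}{|S^{n-1}|}\int_{S^{n-1}}|K\cap\xi^\perp|\,d\xi$ is the average volume of central hyperplane sections. For $\xi\in S^{n-1}$, $\mathrm{as}(K\cap\xi^\perp)$ is the same quantity computed for the star body $K\cap\xi^\perp$ in the $(n-1)$-dimensional Euclidean space $\xi^\perp$, i.e. the average, over unit vectors $\theta\in S^{n-1}\cap\xi^\perp$, of the $(n-2)$-dimensional volumes $|K\cap\xi^\perp\cap\theta^\perp|$. A closed bounded set $K\subset\mathbb{R}^n$ is a star body if every straight line passing through the origin crosses the boundary of $K$ at exactly two points different from the origin, the origin is an interior point of $K$, and the Minkowski functional $\|x\|_K=\min\{a\ge 0: x\in aK\}$ is continuous on $\mathbb{R}^n$. Its radial function is $\rho_K(x)=\|x\|_K^{-1}$. For origin-symmetric star bodies $K,L$ in $\mathbb{R}^n$, $K$ is called the intersection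 body of $L$ if $\rho_K(\xi)=|L\cap\xi^\perp|$ for every $\xi\in S^{n-1}$. The class of intersection bodies is the closure (within origin-symmetric star bodies) of the class of intersection bodies of star bodies in the radial metric $\rho(K,L)=\max_{\xi\in S^{n-1}}|\rho_K(\xi)-\rho_L(\xi)|$. *)

(* Defs.v *)
From HB Require Import structures.
From mathcomp Require Import all_boot all_order all_algebra.
From mathcomp Require Import all_classical all_reals all_analysis.
From mathcomp Require Import measurable_realfun.

Set Implicit Arguments.
Unset Strict Implicit.
Unset Printing Implicit Defensive.

Import Order.TTheory GRing.Theory Num.Theory.
Import numFieldNormedType.Exports.

Local Open Scope classical_set_scope.
Local Open Scope ring_scope.

(* Row vectors carry a topology but no measurable structure; tuples carry the
   product sigma-algebra. Measures are therefore defined on tuples, geometry is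
   done on ['rV[R]_n], and [rv], [tv] are the inverse coordinate bijections. *)

Notation Rtuple R n := (n.-tuple (measurableTypeR R)).

Definition rv (R : realType) n (t : Rtuple R n) : 'rV[R]_n :=
  \row_i (tnth t i : R).

Definition tv (R : realType) n (x : 'rV[R]_n) : Rtuple R n :=
  [tuple (x ord0 i : measurableTypeR R) | i < n].

Lemma rvK (R : realType) n : cancel (@rv R n) (@tv R n).
Proof. by move=> t; apply: eq_from_tnth => i; rewrite tnth_mktuple mxE. Qed.

Lemma tvK (R : realType) n : cancel (@tv R n) (@rv R n).
Proof. by move=> x; apply/rowP => i; rewrite mxE tnth_mktuple. Qed.

Definition cons_tuple_pair (R : realType) n
    (p : measurableTypeR R * Rtuple R n) : Rtuple R n.+1 :=
  [tuple of p.1 :: p.2].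

Fixpoint lebesgue_tuple (R : realType) n : set (Rtuple R n) -> \bar R :=
  match n with
  | 0 => \d_([tuple] : Rtuple R 0)
  | m.+1 => pushforward (lebesgue_measure \x @lebesgue_tuple R m)%E
                        (@cons_tuple_pair R m)
  end.

Section LebesgueTupleTheory.
Context {R : realType}.

Lemma measurable_cons_tuple_pair n :
  measurable_fun [set: _] (@cons_tuple_pair R n).
Proof.
by apply: measurable_cons; [exact: measurable_fst|exact: measurable_snd].
Qed.

Definition uncons_tuple n (t : Rtuple R n.+1) :
    measurableTypeR R * Rtuple R n := (thead t, [tuple of behead t]).

Lemma measurable_uncons_tuple n : measurable_fun [set: _] (@uncons_tuple n).
Proof.
apply/measurable_fun_pairP; split.
  exact: measurable_tnth.
exact: measurable_behead.
Qed.

Lemma cons_tuple_pairK n : cancel (@cons_tuple_pair R n) (@uncons_tuple n).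
Proof. by case=> x t; congr pair; apply/val_inj. Qed.

Lemma uncons_tupleK n : cancel (@uncons_tuple n) (@cons_tuple_pair R n).
Proof. by move=> t; rewrite [RHS]tuple_eta; apply/val_inj. Qed.

Let is_measure d (T : measurableType d) (mu : set T -> \bar R) :=
  [/\ mu set0 = 0%E, forall A, (0 <= mu A)%E, semi_sigma_additive mu &
      sigma_finite [set: T] mu].

Let is_measureP d (T : measurableType d)
  (mu : {sigma_finite_measure set T -> \bar R}) : is_measure mu.
Proof.
split; [exact: measure0|by move=> A; exact: measure_ge0| |].
  exact: measure_semi_sigma_additive.
exact: sigma_finiteT.
Qed.

Let lebesgue_tuple_measure n : is_measure (@lebesgue_tuple R n).
Proof.
elim: n => [|n [mu0 mu_ge0 mu_add mu_sf]]; first exact: is_measureP.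
pose H1 := isMeasure.Build _ _ _ (@lebesgue_tuple R n) mu0 mu_ge0 mu_add.
pose m1 : {measure set (Rtuple R n) -> \bar R} :=
  HB.pack (@lebesgue_tuple R n) H1.
pose H2 := isSFinite.Build _ _ _ (@lebesgue_tuple R n)
  (@sfinite_measure_sigma_finite _ _ _ m1 mu_sf).
pose H3 := isSigmaFinite.Build _ _ _ (@lebesgue_tuple R n) mu_sf.
pose m := HB.pack_for {sigma_finite_measure set (Rtuple R n) -> \bar R}
  (@lebesgue_tuple R n) H1 H2 H3.
pose pm : {measure set (measurableTypeR R * Rtuple R n)%type -> \bar R} :=
  ((@lebesgue_measure R) \x m)%E.
have mc A : measurable A -> measurable (@cons_tuple_pair R n @^-1` A).
  by move=> mA; rewrite -[X in measurable X]setTI;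
    exact: measurable_cons_tuple_pair.
have mu_ A : measurable A -> measurable (@uncons_tuple n @^-1` A).
  by move=> mA; rewrite -[X in measurable X]setTI;
    exact: measurable_uncons_tuple.
change (is_measure (pushforward pm (@cons_tuple_pair R n))).
split.
- by rewrite /pushforward preimage_set0 measure0.
- by move=> A; rewrite /pushforward measure_ge0.
- move=> F mF tF mUF; rewrite /pushforward preimage_bigcup.
  apply: measure_semi_sigma_additive.
  + by move=> k; exact: mc.
  + apply/trivIsetP => /= i j _ _ ij; rewrite -preimage_setI.
    by move/trivIsetP : tF => /(_ _ _ _ _ ij) ->//; rewrite preimage_set0.
  + by rewrite -preimage_bigcup; exact: mc.
- have /sigma_finiteP[F [TF ndF mF]] := sigma_finiteT (@lebesgue_measure R).
  have /sigma_finiteP[G [TG ndG mG]] := sigma_finiteT m.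
  exists (fun i => @uncons_tuple n @^-1` (F i `*` G i)).
    rewrite -preimage_bigcup; apply/esym/seteqP; split=> // t _ /=.
    have [i _ Fi] : (\bigcup_i F i) (uncons_tuple t).1 by rewrite -TF.
    have [j _ Gj] : (\bigcup_i G i) (uncons_tuple t).2 by rewrite -TG.
    exists (maxn i j) => //; split.
      by move: Fi; exact/subsetPset/ndF/leq_maxl.
    by move: Gj; exact/subsetPset/ndG/leq_maxr.
  move=> i; have [mFi Fioo] := mF i; have [mGi Gioo] := mG i.
  split; first by apply: mu_; exact: measurableX.
  rewrite /pushforward -comp_preimage (_ : _ \o _ = id).
    rewrite preimage_id.
    have -> : pm (F i `*` G i) = (lebesgue_measure (F i) * m (G i))%E.
      exact: product_measure1E.
    by rewrite lte_mul_pinfty// ge0_fin_numE.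
  by apply/funext => x /=; rewrite cons_tuple_pairK.
Qed.

HB.instance Definition _ n := isMeasure.Build _ _ _ (@lebesgue_tuple R n)
  (let: And4 p _ _ _ := lebesgue_tuple_measure n in p)
  (let: And4 _ p _ _ := lebesgue_tuple_measure n in p)
  (let: And4 _ _ p _ := lebesgue_tuple_measure n in p).

HB.instance Definition _ n := Measure_isSigmaFinite.Build _ _ _
  (@lebesgue_tuple R n)
  (let: And4 _ _ _ p := lebesgue_tuple_measure n in p).

End LebesgueTupleTheory.

Definition vol (R : realType) n (A : set 'rV[R]_n) : R :=
  fine (lebesgue_tuple (@rv R n @^-1` A)).

Definition dot (R : realType) n (x y : 'rV[R]_n) : R := (x *m y^T) ord0 ord0.

Definition enorm (R : realType) n (x : 'rV[R]_n) : R := Num.sqrt (dot x x).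

Definition ball2 (R : realType) n : set 'rV[R]_n := [set x | enorm x <= 1].

Definition sphere (R : realType) n : set 'rV[R]_n := [set x | enorm x = 1].

Definition normalize (R : realType) n (t : Rtuple R n) : Rtuple R n :=
  tv ((enorm (rv t))^-1 *: rv t).

(* The surface measure of a subset A of the unit sphere is n times the volume
   of the cone over A, { t a | a in A, 0 < t <= 1 }. It is written as a measure
   on the whole space, concentrated on the sphere. *)
Definition surface_measure (R : realType) n (A : set (Rtuple R n)) : \bar R :=
  (n%:R%:E * lebesgue_tuple
     [set t | (0 < enorm (rv t) <= 1)%R /\ A (normalize t)])%E.

Section SurfaceMeasureTheory.
Context {R : realType} (n : nat).

Lemma dotE m (x y : 'rV[R]_m) : dot x y = \sum_i x ord0 i * y ord0 i.
Proof. by rewrite /dot mxE; apply: eq_bigr => i _; rewrite mxE. Qed.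

Lemma measurable_enorm :
  measurable_fun [set: Rtuple R n] (fun t => enorm (rv t)).
Proof.
apply: (measurableT_comp (f := @Num.sqrt R)).
  by apply: continuous_measurable_fun; exact: sqrt_continuous.
rewrite (_ : (fun t => _) =
    fun t : Rtuple R n => \sum_i (tnth t i : R) * (tnth t i : R)).
  by apply: measurable_sum => i; apply: measurable_funM;
    exact: measurable_tnth.
by apply/funext => t; rewrite dotE; apply: eq_bigr => i _; rewrite !mxE.
Qed.

Lemma measurable_inv_realType :
  measurable_fun [set: R] (@GRing.inv R : R -> R).
Proof.
rewrite -(setUv [set (0 : R)]).
apply/measurable_funU => //; first exact: measurableC.
split; first exact: measurable_fun_set1.
apply: open_continuous_measurable_fun.
  by apply: closed_openC; exact: closed_eq.
by move=> x; rewrite inE /= => /eqP x0; exact: inv_continuous.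
Qed.

Lemma measurable_normalize : measurable_fun [set: Rtuple R n] (@normalize R n).
Proof.
apply/measurable_fun_tnthP => i.
rewrite (_ : _ \o _ = fun t => (enorm (rv t))^-1 * (tnth t i : R)).
  apply: measurable_funM; last exact: measurable_tnth.
  exact: (measurableT_comp measurable_inv_realType measurable_enorm).
by apply/funext => t /=; rewrite tnth_mktuple !mxE.
Qed.

Let B : set (Rtuple R n) := [set t | 0 < enorm (rv t) <= 1].

Let mB : measurable B.
Proof.
rewrite (_ : B = [set: _] `&` (fun t => enorm (rv t)) @^-1` `]0, 1]%classic).
  by apply: measurable_enorm => //; exact: measurable_itv.
by rewrite setTI; apply/seteqP; split=> t /=; rewrite in_itv.
Qed.

Let mN (A : set (Rtuple R n)) : measurable A -> measurable (@normalize R n @^-1` A).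
Proof.
by move=> mA; rewrite -[X in measurable X]setTI; exact: measurable_normalize.
Qed.

Let nu : {measure set (Rtuple R n) -> \bar R} :=
  mscale (n%:R%:nng : {nonneg R}) (mrestr (@lebesgue_tuple R n) mB).

Let surfaceE : @surface_measure R n = pushforward nu (@normalize R n).
Proof.
apply/funext => A; rewrite /pushforward /nu /= /mscale /= /mrestr.
by congr (_ * lebesgue_tuple _)%E; apply/seteqP; split=> t [].
Qed.

Let surface0 : @surface_measure R n set0 = 0%E.
Proof. by rewrite surfaceE /pushforward preimage_set0 measure0. Qed.

Let surface_ge0 (A : set (Rtuple R n)) : (0 <= surface_measure A)%E.
Proof. by rewrite /surface_measure mule_ge0// lee_fin. Qed.

Let surface_sigma_additive : semi_sigma_additive (@surface_measure R n).
Proof.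
rewrite surfaceE => F mF tF mUF; rewrite /pushforward preimage_bigcup.
apply: measure_semi_sigma_additive.
- by move=> i; exact: mN.
- apply/trivIsetP => /= i j _ _ ij; rewrite -preimage_setI.
  by move/trivIsetP : tF => /(_ _ _ _ _ ij) ->//; rewrite preimage_set0.
- by rewrite -preimage_bigcup; exact: mN.
Qed.

HB.instance Definition _ := isMeasure.Build _ _ _ (@surface_measure R n)
  surface0 surface_ge0 surface_sigma_additive.

End SurfaceMeasureTheory.

(* For a unit vector [xi]: the rows of [E] form an orthonormal basis of the
   hyperplane perpendicular to [xi]. *)
Definition is_perp_frame (R : realType) n (xi : 'rV[R]_n)
    (E : 'M[R]_(n.-1, n)) : Prop :=
  E *m E^T = 1%:M /\ E *m xi^T = 0.

Lemma is_perp_frame_ex (R : realType) n (xi : 'rV[R]_n) :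
  sphere xi -> exists E, is_perp_frame xi E.
Proof.
case: n xi => [|n] xi; first by exists 0; split; apply/matrixP => -[].
move=> /(congr1 (fun r => r ^+ 2)); rewrite expr1n /= sqr_sqrtr; last first.
  by rewrite dotE sumr_ge0// => i _; rewrite -expr2 sqr_ge0.
move=> xi1; pose e : 'rV[R]_n.+1 := delta_mx 0 0.
have dot_scal (x y : 'rV[R]_n.+1) : x *m y^T = (dot x y)%:M.
  by rewrite [LHS]mx11_scalar.
have dotC (x y : 'rV[R]_n.+1) : dot x y = dot y x.
  by rewrite !dotE; apply: eq_bigr => i _; rewrite mulrC.
have dotBl (x y z : 'rV[R]_n.+1) : dot (x - y) z = dot x z - dot y z.
  by rewrite /dot mulmxBl !mxE.
have dotee : dot e e = 1.
  rewrite dotE (bigD1 ord0)//= big1 => [|i i0]; rewrite !mxE ?eqxx ?mulr1 ?addr0//.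
  by rewrite (negbTE i0) andbF mulr0.
pose v := xi - e; have [c cE] : exists c, c = 2 / dot v v by eexists.
have vv : dot v v = 2 * dot xi v.
  rewrite /v dotBl ![dot _ (xi - e)]dotC !dotBl xi1 dotee (dotC e xi).
  by rewrite mulrBr mulr1 opprB addrACA -opprD -!mulr2n mulr_natl.
have cvv : (c * c * dot v v) *: (v^T *m v) = (2 * c) *: (v^T *m v).
  have [v0|v0] := eqVneq (dot v v) 0.
    by rewrite cE v0 invr0 !(mulr0, mul0r).
  by rewrite {2}cE -mulrA divfK// mulrC.
have cxv : (c * dot xi v) *: v = v.
  have [v0|v0] := eqVneq (dot v v) 0.
    suff -> : v = 0 by rewrite scaler0.
    apply/rowP => i; rewrite [RHS]mxE; apply/eqP; rewrite -sqrf_eq0; apply/eqP.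
    move: v0; rewrite dotE => /eqP; rewrite psumr_eq0 => [/allP/(_ i)|j _].
      by rewrite mem_index_enum -expr2 => /(_ isT)/eqP.
    by rewrite -expr2 sqr_ge0.
  have -> : c * dot xi v = dot v v / dot v v by rewrite cE mulrAC -vv.
  by rewrite divff// scale1r.
pose P : 'M[R]_n.+1 := c *: (v^T *m v); pose H : 'M[R]_n.+1 := 1%:M - P.
have PP : P *m P = P + P.
  rewrite -scalemxAl -scalemxAr mulmxA -[v^T *m v *m v^T]mulmxA dot_scal.
  by rewrite mul_mx_scalar -scalemxAl !scalerA ?mulrA cvv mulr_natl mulr2n scalerDl.
have HT : H^T = H.
  by rewrite /H /P linearB /= trmx1 linearZ /= trmx_mul trmxK.
have HH : H *m H = 1%:M.
  rewrite mulmxBl mul1mx mulmxBr mulmx1 PP opprB addrK.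
  by rewrite /H subrK.
have Hxi : H *m xi^T = e^T.
  rewrite mulmxBl mul1mx -scalemxAl -mulmxA dot_scal mul_mx_scalar scalerA.
  by rewrite dotC -linearZ /= cxv -linearB /= opprB addrC subrK.
exists (row' ord0 H); split; apply/matrixP => i j.
  have := congr1 (fun M : 'M[R]_n.+1 => M (lift ord0 i) (lift ord0 j)) HH.
  rewrite !mxE (inj_eq lift_inj) => <-; apply: eq_bigr => k _.
  by rewrite -{4}HT !mxE.
have := congr1 (fun M : 'cV[R]_n.+1 => M (lift ord0 i) j) Hxi.
rewrite !mxE eqE /= andbF /= => He; rewrite -[RHS]He.
by apply: eq_bigr => k _; rewrite !mxE.
Qed.

Definition perp_frame (R : realType) n (xi : 'rV[R]_n) : 'M[R]_(n.-1, n) :=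
  xget 0 [set E | is_perp_frame xi E].

(* The section of [K] by the hyperplane perpendicular to the unit vector [xi],
   written in orthonormal coordinates of that hyperplane: y |-> y E is a linear
   isometry from R^(n-1) onto the hyperplane, so it carries the Lebesgue
   measure, the unit sphere and the further hyperplane sections of R^(n-1) to
   those of the hyperplane. The volume and the average section computed in
   these coordinates do not depend on the choice of the basis. *)
Definition hsection (R : realType) n (K : set 'rV[R]_n) (xi : 'rV[R]_n) :
    set 'rV[R]_(n.-1) :=
  [set y | K (y *m perp_frame xi)].

Definition sphere_area (R : realType) n : R :=
  fine (surface_measure (@rv R n @^-1` @sphere R n)).

Definition avg_section (R : realType) n (K : set 'rV[R]_n) : R :=
  (sphere_area R n)^-1 *
  \int[@surface_measure R n]_(t in @rv R n @^-1` @sphere R n)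
    vol (hsection K (rv t)).

Definition boundary (T : topologicalType) (A : set T) : set T :=
  closure A `\` A°.

(* For a star body the infimum is a minimum. *)
Definition minkowski (R : realType) n (K : set 'rV[R]_n) (x : 'rV[R]_n) : R :=
  inf [set a | 0 <= a /\ exists2 y, K y & x = a *: y].

Definition radial (R : realType) n (K : set 'rV[R]_n) (x : 'rV[R]_n) : R :=
  (minkowski K x)^-1.

Definition star_body (R : realType) n (K : set 'rV[R]_n) : Prop :=
  [/\ closed K, bounded_set K,
      forall u : 'rV[R]_n, u != 0 -> exists a b : R,
        [/\ a != 0, b != 0, a != b &
            [set t : R | t != 0 /\ boundary K (t *: u)] = [set a; b]],
      K° 0 &
      continuous (minkowski K)].

Definition origin_symmetric (R : realType) n (K : set 'rV[R]_n) : Prop :=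
  forall x, K x -> K (- x).

Definition sym_star_body (R : realType) n (K : set 'rV[R]_n) : Prop :=
  star_body K /\ origin_symmetric K.

Definition intersection_body_of (R : realType) n (K L : set 'rV[R]_n) : Prop :=
  [/\ sym_star_body K, sym_star_body L &
      forall xi, sphere xi -> radial K xi = vol (hsection L xi)].

(* For star bodies the supremum is a maximum. *)
Definition radial_dist (R : realType) n (K L : set 'rV[R]_n) : R :=
  sup [set `|radial K xi - radial L xi| | xi in @sphere R n].

Definition intersection_body (R : realType) n (K : set 'rV[R]_n) : Prop :=
  sym_star_body K /\
  forall e : R, 0 < e -> exists K' L : set 'rV[R]_n,
    intersection_body_of K' L /\ radial_dist K K' < e.

Definition is_sphere_max (R : realType) n (f : 'rV[R]_n -> R) (M : R) : Prop :=
  (exists2 xi, sphere xi & f xi = M) /\ forall xi, sphere xi -> f xi <= M.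

(* Main.v *)
Require Import Defs.
From mathcomp Require Import all_boot all_order all_algebra.
From mathcomp Require Import all_classical all_reals all_analysis.
From mathcomp Require Import measurable_realfun ring lra.
Set Implicit Arguments.
Unset Strict Implicit.
Unset Printing Implicit Defensive.
Import Order.TTheory GRing.Theory Num.Theory.
Import numFieldNormedType.Exports.
Local Open Scope classical_set_scope.
Local Open Scope ring_scope.

(* Write [A] for the average over the sphere, [rho] for the radial function of
   [K] and [T h xi] for the average of [h] over the unit sphere of [xi^perp].
   Polar coordinates give [as K = |B^(n-1)| A (rho^(n-1))],
   [as (K cap xi^perp) = |B^(n-2)| T (rho^(n-2)) xi] and
   [|K| = |B^n| A (rho^n)]. If [rho = T f] with [f >= 0], then, [T] being
   self-adjoint and preserving averages,
   [A (rho^(n-1)) = A (T (rho^(n-2)) f) <= max T (rho^(n-2)) * A f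
    = max T (rho^(n-2)) * A rho], and [A rho <= A (rho^n)^(1/n)].

   A function on the sphere is represented by its 0-homogeneous extension, and
   its average is taken over the punctured unit ball of Lebesgue measure.
   Self-adjointness is obtained by approximating [T h xi] by averages of [h]
   over thin slabs around [xi^perp], whose kernel is visibly symmetric. *)

(** * Lebesgue integration over row vectors *)

(** An intersection body is only a limit of bodies with [rho = T f]. It suffices to approximate one
    of the factors [rho] in [rho^(n-1)]: [rho^(n-2)] stays that of [K], so the maximum on the right
    is never perturbed. The formula for [as K] already uses [A (T h) = A h], because [as K] averages
    the section volumes [|B^(n-1)| T (rho^(n-1))]; this is self-adjointness tested against the
    constant [1]. Slabs are needed because the pairs [x], [y] with [dot x y = 0] form a null set:
    thickened, they give a kernel to which Tonelli applies. Hyperplanes are seen through orthonormal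
    frames chosen arbitrarily for each normal. Invariance of Lebesgue measure under orthogonal maps
    makes the averages independent of the choice; a reflection supplies nearby frames for nearby
    normals, hence the continuity of [T h]. For the ball [rho = 1], every average is [1], and the
    constant of the theorem is the resulting quotient of ball volumes. *)

Section RowMeasurable.
Context {R : realType}.
Implicit Types n : nat.

Definition measurable_row d (T : measurableType d) n (f : T -> 'rV[R]_n) :=
  forall i, measurable_fun [set: T] (fun t => f t ord0 i).

Definition borel_row n (F : 'rV[R]_n -> \bar R) :=
  measurable_fun [set: Rtuple R n] (F \o @rv R n).

Definition lint n (F : 'rV[R]_n -> \bar R) : \bar R :=
  (\int[@lebesgue_tuple R n]_t F (rv t))%E.

Definition cons_row n (s : R) (x : 'rV[R]_n) : 'rV[R]_n.+1 :=
  row_mx (s%:M : 'M[R]_1) x.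

Lemma borel_rowP d (T : measurableType d) n (F : 'rV[R]_n -> \bar R)
    (f : T -> 'rV[R]_n) : borel_row F -> measurable_row f ->
  measurable_fun [set: T] (F \o f).
Proof.
move=> mF mf.
have -> : F \o f = (F \o @rv R n) \o (@tv R n \o f).
  by apply/funext => t /=; rewrite tvK.
apply: measurableT_comp => //.
apply/measurable_fun_tnthP => i.
by apply: eq_measurable_fun (mf i) => t _ /=; rewrite tnth_mktuple.
Qed.

Lemma measurable_row_rv n : measurable_row (@rv R n).
Proof.
move=> i; apply: eq_measurable_fun (measurable_tnth i) => t _.
by rewrite mxE.
Qed.

Lemma ge0_pushforward_fubini d1 d2 d (T1 : measurableType d1)
    (T2 : measurableType d2) (T : measurableType d)
    (m1 : {sigma_finite_measure set T1 -> \bar R})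
    (m2 : {sigma_finite_measure set T2 -> \bar R}) (phi : T1 * T2 -> T)
    (f : T -> \bar R) :
  measurable_fun setT phi -> measurable_fun setT f ->
  (forall x, (0 <= f x)%E) ->
  (\int[pushforward (m1 \x m2)%E phi]_t f t =
   \int[m1]_x \int[m2]_y f (phi (x, y)))%E.
Proof.
move=> mphi mf f0; rewrite ge0_integral_pushforward// preimage_setT.
have mfp : measurable_fun setT (f \o phi) by exact: measurableT_comp.
by rewrite (fubini_tonelli1 _ mfp)//= => x; exact: f0.
Qed.

Lemma lintS n (F : 'rV[R]_n.+1 -> \bar R) : borel_row F ->
  (forall x, (0 <= F x)%E) ->
  lint F = (\int[@lebesgue_measure R]_s lint (fun x => F (cons_row s x)))%E.
Proof.
move=> mF F0; rewrite /lint.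
have h := @ge0_pushforward_fubini _ _ _ _ _ _ (@lebesgue_measure R)
  (@lebesgue_tuple R n) (@cons_tuple_pair R n) (F \o @rv R n.+1)
  (@measurable_cons_tuple_pair R n) mF (fun x => F0 _).
apply: (etrans h).
apply: eq_integral => s _; apply: eq_integral => t _.
rewrite /=; congr F; apply/rowP => i; rewrite /cons_row !mxE.
case: splitP => j ij; rewrite !mxE.
  rewrite (_ : i = ord0) ?ord1 ?mulr1n//; apply/val_inj; by rewrite /= ij ord1.
by rewrite (_ : i = lift ord0 j) ?tnthS//; apply/val_inj.
Qed.
End RowMeasurable.

Section RowClosure.
Context {R : realType} d (T : measurableType d).
Implicit Types n : nat.

Lemma measurable_row_mulmx n m (f : T -> 'rV[R]_n) (A : 'M[R]_(n, m)) :
  measurable_row f -> measurable_row (fun t => f t *m A).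
Proof.
move=> mf i.
apply: (eq_measurable_fun (fun t => \sum_j f t ord0 j * A j i)).
  by move=> t _; rewrite mxE.
by apply: measurable_sum => j; apply: measurable_funM.
Qed.

Lemma measurable_row_cst n (v : 'rV[R]_n) : measurable_row (fun _ : T => v).
Proof. by move=> i; exact: measurable_cst. Qed.

Lemma measurable_rowD n (f g : T -> 'rV[R]_n) :
  measurable_row f -> measurable_row g -> measurable_row (fun t => f t + g t).
Proof.
move=> mf mg i; apply: (eq_measurable_fun (fun t => f t ord0 i + g t ord0 i)).
  by move=> t _; rewrite mxE.
exact: measurable_funD.
Qed.

Lemma measurable_rowZ n (c : T -> R) (f : T -> 'rV[R]_n) :
  measurable_fun setT c -> measurable_row f ->
  measurable_row (fun t => c t *: f t).
Proof.
move=> mc mf i; apply: (eq_measurable_fun (fun t => c t * f t ord0 i)).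
  by move=> t _; rewrite mxE.
exact: measurable_funM.
Qed.

Lemma measurable_rowN n (f : T -> 'rV[R]_n) :
  measurable_row f -> measurable_row (fun t => - f t).
Proof.
move=> mf i; apply: (eq_measurable_fun (fun t => - f t ord0 i)).
  by move=> t _; rewrite mxE.
exact: measurable_funN.
Qed.

Lemma measurable_row_cons n (s : T -> R) (f : T -> 'rV[R]_n) :
  measurable_fun setT s -> measurable_row f ->
  measurable_row (fun t => cons_row (s t) (f t)).
Proof.
move=> ms mf i; rewrite /cons_row; case: (splitP (i : 'I_(1 + n))) => j ij.
  apply: (eq_measurable_fun s) => // t _; rewrite mxE.
  case: splitP => k ik; first by rewrite mxE !ord1.
  by have := ltn_ord j; rewrite -ij ik.
apply: (eq_measurable_fun (fun t => f t ord0 j)) => // t _; rewrite mxE.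
case: splitP => k ik; first by have := ltn_ord k; rewrite -ik ij.
by congr (f t _ _); apply/val_inj; apply: (@addnI 1); rewrite -ij -ik.
Qed.

Lemma measurable_row_comp d' (T' : measurableType d') n (f : T -> 'rV[R]_n)
    (g : T' -> T) : measurable_row f -> measurable_fun setT g ->
  measurable_row (f \o g).
Proof. by move=> mf mg i; exact: measurableT_comp (mf i) mg. Qed.

Lemma measurable_dot n (f g : T -> 'rV[R]_n) : measurable_row f ->
  measurable_row g -> measurable_fun setT (fun t => dot (f t) (g t)).
Proof.
move=> mf mg; under eq_fun do rewrite dotE.
by apply: measurable_sum => i; apply: measurable_funM.
Qed.

Lemma measurable_enorm_row n (f : T -> 'rV[R]_n) : measurable_row f ->
  measurable_fun setT (fun t => enorm (f t)).
Proof.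
move=> mf; apply: (measurableT_comp (f := @Num.sqrt R)).
  by apply: continuous_measurable_fun; exact: sqrt_continuous.
exact: measurable_dot.
Qed.

Lemma measurable_indb (b : T -> bool) : measurable_fun setT b ->
  measurable_fun setT (fun t => (b t)%:R : R).
Proof.
by move=> mb; exact: (measurableT_comp (f := fun c : bool => c%:R : R)).
Qed.

Lemma measurable_lint n (F : T -> 'rV[R]_n -> \bar R) :
  measurable_fun setT (fun p : T * Rtuple R n => F p.1 (rv p.2)) ->
  (forall t x, (0 <= F t x)%E) ->
  measurable_fun setT (fun t => lint (F t)).
Proof.
move=> mF F0.
exact: (measurable_fun_fubini_tonelli_F (m2 := @lebesgue_tuple R n) _ mF).
Qed.

End RowClosure.

Section AffineChange.
Context {R : realType}.

(** The image of Lebesgue measure under [s |-> c * s + v], multiplied by [c], gives every half-open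
    interval its length, so it is Lebesgue measure. *)
Lemma integral_affine (F : R -> \bar R) (c v : R) : 0 < c ->
  measurable_fun setT F -> (forall x, (0 <= F x)%E) ->
  (\int[@lebesgue_measure R]_s F s =
   c%:E * \int[@lebesgue_measure R]_s F (c * s + v)%R)%E.
Proof.
move=> c0 mF F0.
pose phi (s : measurableTypeR R) : measurableTypeR R := c * s + v.
have mphi : measurable_fun setT phi.
  by apply: measurable_funD => //; apply: measurable_funM.
have h := ge0_integral_pushforward mphi (@lebesgue_measure R) measurableT mF
  (fun y _ => F0 y).
have -> : (\int[@lebesgue_measure R]_s F (c * s + v)%R =
  \int[pushforward (@lebesgue_measure R) phi]_s F s)%E.
  by rewrite h preimage_setT.
pose k : {nonneg R} := NngNum (ltW c0).
pose mu0 : {measure set (measurableTypeR R) -> \bar R} :=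
  mscale k (pushforward (@lebesgue_measure R) phi).
pose mu' := mu0 mphi.
transitivity (\int[mu']_s F s)%E; last first.
  by rewrite ge0_integral_mscale.
apply: eq_measure_integral => /= A mA _.
apply: (lebesgue_measure_unique (mu := mu')) => // _ [[a b]] _ <-.
rewrite /mu' /mu0 /= /mscale /= /pushforward /=.
rewrite (_ : phi @^-1` _ = `](a - v) / c, (b - v) / c]%classic); last first.
  apply/seteqP; split => x /=; rewrite !in_itv /= /phi;
  by rewrite ltr_pdivrMr// ler_pdivlMr// ltrBlDr lerBrDr ![x * c]mulrC.
rewrite !lebesgue_measure_itv /= !lte_fin ltr_pM2r ?invr_gt0// ltrD2r.
case: ifPn => _; last by rewrite mule0.
by rewrite -!EFinD -EFinM; congr (_%:E); field; exact: lt0r_neq0.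
Qed.

Lemma lint0 (F : 'rV[R]_0 -> \bar R) : lint F = F 0.
Proof.
rewrite /lint (_ : (fun t => _) = cst (F 0)).
  by rewrite integral_dirac// diracE in_setT mul1e.
by apply/funext => t; congr F; apply/rowP => -[].
Qed.

(** Each coordinate contributes one factor [c], by Tonelli and the one-dimensional case. *)
Lemma lint_affine n (F : 'rV[R]_n -> \bar R) (c : R) (v : 'rV[R]_n) : 0 < c ->
  borel_row F -> (forall x, (0 <= F x)%E) ->
  (lint F = (c ^+ n)%:E * lint (fun x => F (c *: x + v)%R))%E.
Proof.
move=> c0; elim: n F v => [|n IH] F v mF F0.
  by rewrite !lint0 expr0 mul1e; congr F; apply/rowP => -[].
have mG : borel_row (fun x => F (c *: x + v)).
  apply: (borel_rowP mF); apply: measurable_rowD;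
    last exact: measurable_row_cst.
  by apply: measurable_rowZ => //; exact: measurable_row_rv.
rewrite !lintS//.
have msec s : borel_row (fun x => F (cons_row s x)).
  by apply: (borel_rowP mF); apply: measurable_row_cons => //;
    exact: measurable_row_rv.
pose w : 'rV[R]_n := \row_i v ord0 (lift ord0 i).
have jm (f : R -> R) (g : 'rV[R]_n -> 'rV[R]_n) : measurable_fun setT f ->
    measurable_row (g \o @rv R n) ->
    measurable_fun setT
     (fun p : measurableTypeR R * Rtuple R n => F (cons_row (f p.1) (g (rv
       p.2)))).
  move=> mf mg; apply: (borel_rowP mF); apply: measurable_row_cons.
    exact: (measurableT_comp mf).
  exact: (measurable_row_comp mg).
under eq_integral => s _ do rewrite (IH _ w (msec s))//.
have ml : measurable_fun setT
    (fun s => lint (fun x => F (cons_row s (c *: x + w)))).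
  apply: measurable_lint => //.
  have mh : measurable_row (fun t : Rtuple R n => c *: rv t + w).
    apply: measurable_rowD; last exact: measurable_row_cst.
    by apply: measurable_rowZ => //; exact: measurable_row_rv.
  exact: (jm _ (fun x => c *: x + w) (@measurable_id _ _ _) mh).
have l0 s : (0 <= lint (fun x => F (cons_row s (c *: x + w))))%E.
  exact: integral_ge0.
rewrite ge0_integralZl//; last by rewrite lee_fin exprn_ge0// ltW.
rewrite (@integral_affine (fun s => lint (fun x => F (cons_row s (c *: x + w))))
  c (v ord0 ord0))//.
rewrite muleA -EFinM -exprSr.
congr (_ * _)%E; apply: eq_integral => s _; apply: eq_integral => t _.
congr F; apply/rowP => i; rewrite !mxE.
case: splitP => j ij; rewrite !mxE.
  rewrite (_ : i = ord0) ?ord1 ?mulr1n//; apply/val_inj; by rewrite /= ij ord1.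
by rewrite (_ : i = lift ord0 j)//; apply/val_inj.
Qed.
End AffineChange.

Section Fubini.
Context {R : realType}.

Lemma measurable_row_fst n d (T : measurableType d) :
  measurable_row (fun p : Rtuple R n * T => rv p.1).
Proof. exact: (measurable_row_comp (@measurable_row_rv R n) measurable_fst).
  Qed.

Lemma measurable_row_snd n d (T : measurableType d) :
  measurable_row (fun p : T * Rtuple R n => rv p.2).
Proof. exact: (measurable_row_comp (@measurable_row_rv R n) measurable_snd).
  Qed.

Lemma lint_swap n m (F : 'rV[R]_n -> 'rV[R]_m -> \bar R) :
  measurable_fun setT
    (fun p : Rtuple R n * Rtuple R m => F (rv p.1) (rv p.2)) ->
  (forall x y, (0 <= F x y)%E) ->
  lint (fun x => lint (F x)) = lint (fun y => lint (F ^~ y)).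
Proof.
move=> mF F0.
exact: (fubini_tonelli (m1 := @lebesgue_tuple R n) (m2 := @lebesgue_tuple R m)
  _ mF (fun=> F0 _ _)).
Qed.

Lemma lint_swap1 n (F : R -> 'rV[R]_n -> \bar R) :
  measurable_fun setT
    (fun p : measurableTypeR R * Rtuple R n => F p.1 (rv p.2)) ->
  (forall x y, (0 <= F x y)%E) ->
  (\int[@lebesgue_measure R]_s lint (F s) =
   lint (fun y => \int[@lebesgue_measure R]_s F s y))%E.
Proof.
move=> mF F0.
exact: (fubini_tonelli (m1 := @lebesgue_measure R) (m2 := @lebesgue_tuple R n)
  _ mF (fun=> F0 _ _)).
Qed.

Lemma lintZl n (k : \bar R) (F : 'rV[R]_n -> \bar R) : borel_row F ->
  (forall x, (0 <= F x)%E) -> (0 <= k)%E ->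
  (lint (fun x => k * F x) = k * lint F)%E.
Proof. by move=> mF F0 k0; exact: ge0_integralZl. Qed.

Lemma lintZr n (k : \bar R) (F : 'rV[R]_n -> \bar R) : borel_row F ->
  (forall x, (0 <= F x)%E) -> (0 <= k)%E ->
  (lint (fun x => F x * k) = lint F * k)%E.
Proof. by move=> mF F0 k0; exact: ge0_integralZr. Qed.

Lemma lint_ge0 n (F : 'rV[R]_n -> \bar R) :
  (forall x, (0 <= F x)%E) -> (0 <= lint F)%E.
Proof. by move=> F0; exact: integral_ge0. Qed.

Lemma le_lint n (F G : 'rV[R]_n -> \bar R) : borel_row F -> borel_row G ->
  (forall x, (0 <= F x)%E) -> (forall x, (F x <= G x)%E) ->
  (lint F <= lint G)%E.
Proof.
by move=> mF mG F0 FG; exact: ge0_le_integral.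
Qed.

Lemma lint_trans n (F : 'rV[R]_n -> \bar R) v : borel_row F ->
  (forall x, (0 <= F x)%E) -> lint (fun x => F (x + v)) = lint F.
Proof.
move=> mF F0; rewrite [RHS](@lint_affine _ _ _ 1 v)// expr1n mul1e.
by congr lint; apply/funext => x; rewrite scale1r.
Qed.

End Fubini.

Lemma cons_row0 (R : realType) n s (x : 'rV[R]_n) : cons_row s x ord0 ord0 = s.
Proof.
rewrite /cons_row mxE; case: splitP => // k _.
by rewrite mxE !ord1 mulr1n.
Qed.

Lemma cons_row_lift (R : realType) n s (x : 'rV[R]_n) i :
  cons_row s x ord0 (lift ord0 i) = x ord0 i.
Proof.
rewrite /cons_row mxE; case: splitP => [k|k ik].
  by rewrite ord1.
by congr (x _ _); apply/val_inj; apply: (@addnI 1).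
Qed.

Section Enorm.
Context {R : realType} {n : nat}.
Implicit Types x y : 'rV[R]_n.

Lemma dotC x y : dot x y = dot y x.
Proof. by rewrite !dotE; apply: eq_bigr => i _; rewrite mulrC. Qed.

Lemma dotDl x y z : dot (x + y) z = dot x z + dot y z.
Proof. by rewrite /dot mulmxDl mxE. Qed.

Lemma dotDr x y z : dot z (x + y) = dot z x + dot z y.
Proof. by rewrite dotC dotDl !(dotC z). Qed.

Lemma dotZl c x y : dot (c *: x) y = c * dot x y.
Proof. by rewrite /dot -scalemxAl mxE. Qed.

Lemma dotZr c x y : dot x (c *: y) = c * dot x y.
Proof. by rewrite dotC dotZl dotC. Qed.

Lemma dotNr x y : dot x (- y) = - dot x y.
Proof. by rewrite -scaleN1r dotZr mulN1r. Qed.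

Lemma dotNl x y : dot (- x) y = - dot x y.
Proof. by rewrite dotC dotNr dotC. Qed.

Lemma dot_ge0 x : 0 <= dot x x.
Proof. by rewrite dotE sumr_ge0// => i _; rewrite -expr2 sqr_ge0. Qed.

Lemma enorm_sqr x : enorm x ^+ 2 = dot x x.
Proof. by rewrite sqr_sqrtr// dot_ge0. Qed.

Lemma enorm_ge0 x : 0 <= enorm x.
Proof. exact: sqrtr_ge0. Qed.

Lemma enormZ c x : enorm (c *: x) = `|c| * enorm x.
Proof.
rewrite /enorm dotZl dotZr mulrA -expr2 sqrtrM ?sqr_ge0//.
by rewrite sqrtr_sqr.
Qed.

Lemma enormN x : enorm (- x) = enorm x.
Proof. by rewrite -scaleN1r enormZ normrN1 mul1r. Qed.

Lemma coord_le_enorm x i : `|x ord0 i| <= enorm x.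
Proof.
rewrite -[leLHS]sqrtr_sqr ler_sqrt ?dot_ge0// dotE (bigD1 i)//= -expr2 lerDl.
by rewrite sumr_ge0// => j _; rewrite -expr2 sqr_ge0.
Qed.

Lemma enorm_eq0 x : (enorm x == 0) = (x == 0).
Proof.
apply/eqP/eqP => [x0|->]; last by rewrite -(scale0r 0) enormZ normr0 mul0r.
apply/rowP => i; rewrite mxE; apply/eqP; rewrite -normr_le0 -x0.
exact: coord_le_enorm.
Qed.

Lemma enorm_gt0 x : (0 < enorm x) = (x != 0).
Proof. by rewrite lt0r enorm_eq0 enorm_ge0 andbT. Qed.

Lemma enorm_le_coord x c : 0 <= c -> (forall i, `|x ord0 i| <= c) ->
  enorm x <= n%:R * c.
Proof.
move=> c0 xc; rewrite -[leRHS]ger0_norm ?mulr_ge0// -sqrtr_sqr.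
rewrite ler_sqrt ?sqr_ge0// dotE.
apply: (@le_trans _ _ (\sum_(i < n) c ^+ 2)).
  apply: ler_sum => i _; rewrite -expr2 -[leLHS]real_normK ?num_real//.
  by rewrite ler_pXn2r// nnegrE.
rewrite sumr_const card_ord -[leLHS]mulr_natl exprMn ler_wpM2r ?sqr_ge0//.
by rewrite -natrX ler_nat; case: n => // k; rewrite leq_pmulr.
Qed.

End Enorm.

Lemma enorm_isom (R : realType) n m (x : 'rV[R]_n) (A : 'M[R]_(n, m)) :
  A *m A^T = 1%:M -> enorm (x *m A) = enorm x.
Proof.
by move=> AA; rewrite /enorm /dot trmx_mul mulmxA -(mulmxA x) AA mulmx1.
Qed.

(** * Measure of the ball and invariance under orthogonal maps *)

Section BallMeasure.
Context {R : realType}.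

Definition ind_ball n (x : 'rV[R]_n) : \bar R := (enorm x <= 1)%R%:R%:E.

Lemma ind_ge0 (b : bool) : (0 <= b%:R%:E :> \bar R)%E.
Proof. by rewrite lee_fin. Qed.

Lemma borel_ind_ball n : borel_row (@ind_ball n).
Proof.
apply/measurable_EFinP; apply: measurable_indb.
by apply: measurable_fun_ler => //;
  exact: measurable_enorm_row (@measurable_row_rv R n).
Qed.

(** Cubes have a product structure, so their volume is found by induction; one inside and one around
    the ball show that its measure is positive and finite. *)
Let cube n (c : R) (x : 'rV[R]_n) : \bar R :=
  [forall i, (`|x ord0 i| <= c)%R]%:R%:E.

Let borel_cube n c : borel_row (@cube n c).
Proof.
rewrite /borel_row (_ : _ \o _ = fun t : Rtuple R n =>
    (\prod_i (`|rv t ord0 i| <= c)%R%:R)%:E); last first.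
  apply/funext => t /=; rewrite /cube; congr _%:E.
  case: forallP => [h|h].
    by rewrite big1// => i _; rewrite h.
  have [i hi] : exists i, ~~ (`|rv t ord0 i| <= c).
    by apply/existsP; apply: contrapT => /negP;
      rewrite negb_exists => /forallP hh;
      apply: h => i; have := hh i; rewrite negbK.
  by rewrite (bigD1 i)//= (negbTE hi) mul0r.
apply/measurable_EFinP; apply: measurable_prod => i _.
apply: measurable_indb; apply: measurable_fun_ler => //.
by apply: measurableT_comp => //; exact: measurable_row_rv.
Qed.

Let cubeS n c s x : @cube n.+1 c (cons_row s x) =
  ((`|s| <= c)%R%:R%:E * cube c x)%E.
Proof.
rewrite /cube -EFinM -natrM mulnb; congr ((nat_of_bool _)%:R%:E).
apply/forallP/andP => [h|[h1 /forallP h2] i].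
  split; first by have := h ord0; rewrite cons_row0.
  by apply/forallP => i; have := h (lift ord0 i); rewrite cons_row_lift.
by case: (unliftP ord0 i) => [j|] ->; rewrite ?cons_row0 ?cons_row_lift.
Qed.

Let lint_cube n (c : R) : 0 <= c -> lint (@cube n c) = ((2 * c) ^+ n)%:E.
Proof.
move=> c0; elim: n => [|n IH].
  by rewrite lint0 /cube expr0; case: forallP => // -[] [].
rewrite lintS; [|exact: borel_cube|by move=> x; exact: ind_ge0].
have cubeE s : (fun x => cube c (cons_row s x)) =
    (fun x : 'rV_n => (`|s| <= c)%R%:R%:E * cube c x)%E.
  by apply/funext => x; exact: cubeS.
have cube0 x : (0 <= @cube n c x)%E by exact: ind_ge0.
under eq_integral => s _ do
  rewrite cubeE (lintZl (@borel_cube n c) cube0 (ind_ge0 _)) IH muleC.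
rewrite ge0_integralZl//; last 2 first.
  - apply/measurable_EFinP; apply: measurable_indb.
    exact: measurable_fun_ler.
  - by rewrite lee_fin exprn_ge0// mulr_ge0.
rewrite exprSr EFinM; congr (_ * _)%E.
rewrite (_ : (fun s : R => _) = (fun s => (\1_(`[- c, c]%classic) s)%:E)).
  rewrite integral_indic//= setIT lebesgue_measure_itv/= lte_fin.
  case: ltrP => cc; first by rewrite -EFinB opprK mulr2n mulrDl mul1r.
  by have -> : c = 0; [lra|rewrite mulr0].
apply/funext => s; rewrite indicE mem_setE /=.
by rewrite in_itv /= ler_norml.
Qed.

Lemma lint_ball_fin_gt0 n :
  (0 < lint (@ind_ball n) < +oo)%E.
Proof.
apply/andP; split.
  (* Half-side [1 / (n + 1)] puts the cube inside the ball, since [enorm x <= n * c]; [n.+1] instead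
     of [n] keeps it positive in dimension [0]. *)
  have c0 : 0 < (n.+1%:R^-1 : R) by rewrite invr_gt0.
  apply: (@lt_le_trans _ _ (lint (@cube n n.+1%:R^-1))).
    by rewrite lint_cube ?ltW// lte_fin exprn_gt0// mulr_gt0.
  apply: le_lint; [exact: borel_cube|exact: borel_ind_ball| |].
    by move=> x; exact: ind_ge0.
  move=> x; rewrite /cube /ind_ball lee_fin ler_nat.
  case: forallP => // h; rewrite lt0b (le_trans (enorm_le_coord (ltW c0) h))//.
  by rewrite ler_pdivrMr// mul1r ler_nat.
apply: (@le_lt_trans _ _ (lint (@cube n 1))); last by rewrite lint_cube// ltry.
apply: le_lint; [exact: borel_ind_ball|exact: borel_cube| |].
  by move=> x; exact: ind_ge0.
move=> x; rewrite /cube /ind_ball lee_fin ler_nat.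
case: leP => // x1; rewrite lt0b; apply/forallP => i.
exact: le_trans (coord_le_enorm _ _) x1.
Qed.

(* Uniqueness of Haar measure: [J F = lint (F \o *m A)] is translation
   invariant, so Tonelli gives [J F * lint b = lint (F \o -%R) * J b] for
   every [b]; the unit ball is a [b] with [J b = lint b]. *)
Lemma lint_isom n (A : 'M[R]_n) (F : 'rV[R]_n -> \bar R) :
  A *m A^T = 1%:M -> borel_row F -> (forall x, (0 <= F x)%E) ->
  lint (fun x => F (x *m A)) = lint F.
Proof.
move=> AA mF F0.
have AA' : A^T *m A = 1%:M by exact: mulmx1C.
pose b := @ind_ball n.
have b0 x : (0 <= b x)%E by exact: ind_ge0.
have mb : borel_row b by exact: borel_ind_ball.
have main (B : 'M[R]_n) : B *m B^T = 1%:M ->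
    lint (fun x => F (x *m B)) = lint (fun x => F (- x)).
  move=> BB; have BB' : B^T *m B = 1%:M by exact: mulmx1C.
  have mxB m : measurable_row (fun p : Rtuple R n * Rtuple R m => rv p.1 *m B).
    by apply: measurable_row_mulmx; exact: measurable_row_fst.
  have mrB : measurable_row (fun t : Rtuple R n => rv t *m B).
    by apply: measurable_row_mulmx; exact: measurable_row_rv.
  have Jtrans G v : borel_row G -> (forall x, 0 <= G x)%E ->
      lint (fun x => G (x *m B + v)) = lint (fun x => G (x *m B)).
    move=> mG G0.
    rewrite -(@lint_trans _ _ (fun x => G (x *m B)) (v *m B^T))//; last first.
      exact: (borel_rowP mG).
    by congr lint; apply/funext => x; rewrite mulmxDl -mulmxA BB' mulmx1.
  suff : (lint (fun x => F (x *m B)) * lint b = lint (fun x => F (- x)%R) *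
    lint b)%E.
    have /andP[l0 l1] := lint_ball_fin_gt0 n.
    have fl : lint b \is a fin_num by rewrite ge0_fin_numE// ltW.
    have r0 : 0 < fine (lint b) by apply: fine_gt0; rewrite l0.
    rewrite -(fineK fl) => /(congr1 (fun z => z * (fine (lint b))^-1%:E)%E).
    by rewrite -!muleA -!EFinM mulfV ?mule1// gt_eqF.
  transitivity (lint (fun x => lint (fun y => F (x *m B) * b (y + x *m
    B)%R))%E).
    rewrite -lintZr//; last 2 first.
      exact: (borel_rowP mF).
      exact: lint_ge0.
    congr lint; apply/funext => x.
    rewrite -(lint_trans (x *m B) mb b0) lintZl//.
    apply: (borel_rowP mb); apply: measurable_rowD;
      last exact: measurable_row_cst.
    exact: measurable_row_rv.
  rewrite lint_swap; last 2 first.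
  - apply: emeasurable_funM; first exact: (borel_rowP mF).
    by apply: (borel_rowP mb); apply: measurable_rowD => //;
      exact: measurable_row_snd.
  - by move=> x y; rewrite mule_ge0.
  (* Invariance of [J] under translation by [- y] moves the shift from [b] to [F]; after the next
     swap the integral over [y] no longer depends on [x]. *)
  transitivity (lint (fun y => lint (fun x => F (x *m B - y)%R * b (x *m
    B)))%E).
    congr lint; apply/funext => y.
    rewrite -(Jtrans (fun z => F z * b (y + z)%R)%E (- y)); last 2 first.
    - apply: emeasurable_funM => //; apply: (borel_rowP mb).
      by apply: measurable_rowD;
        [exact: measurable_row_cst|exact: measurable_row_rv].
    - by move=> x; rewrite mule_ge0.
    congr lint; apply/funext => x; congr (_ * b _)%E.
    by rewrite addrC subrK.
  rewrite lint_swap; last 2 first.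
  - apply: emeasurable_funM; last first.
      by apply: (borel_rowP mb); apply: measurable_row_mulmx;
        exact: measurable_row_snd.
    apply: (borel_rowP mF); apply: measurable_rowD.
      by apply: measurable_row_mulmx; exact: measurable_row_snd.
    by apply: measurable_rowN; exact: measurable_row_fst.
  - by move=> x y; rewrite mule_ge0.
  have mFN : borel_row (fun x => F (- x)).
    by apply: (borel_rowP mF); apply: measurable_rowN; exact: measurable_row_rv.
  rewrite -lintZl//; last exact: lint_ge0.
  congr lint; apply/funext => x; rewrite lintZr//; last first.
    apply: (borel_rowP mF); apply: measurable_rowD;
      first exact: measurable_row_cst.
    by apply: measurable_rowN; exact: measurable_row_rv.
  congr (_ * _)%E; last by rewrite /b /ind_ball enorm_isom.
  rewrite -(lint_trans (- (x *m B)) mFN)//.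
  by congr lint; apply/funext => y; rewrite opprD opprK addrC.
(* [main] produces the reflected integral for every orthogonal matrix; the identity matrix removes
   the reflection. *)
rewrite main// -(main 1%:M) ?trmx1 ?mulmx1//.
by congr lint; apply/funext => x; rewrite mulmx1.
Qed.

End BallMeasure.

(** * Continuous functions on the sphere and their averages *)

Section EnormTopology.
Context {R : realType} {n : nat}.
Implicit Types x y : 'rV[R]_n.

Lemma norm_le_enorm x : `|x| <= enorm x.
Proof.
rewrite [leLHS]/Num.norm /= mx_normrE; apply/bigmax_leP; split => [|i _].
  exact: enorm_ge0.
by rewrite ord1; exact: coord_le_enorm.
Qed.

Lemma continuous_row (T : topologicalType) (f : T -> 'rV[R]_n) (t : T) :
  (forall i, {for t, continuous (fun s => f s ord0 i)}) ->
  {for t, continuous f}.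
Proof.
move=> cf; apply/cvgrPdist_lt => e e0.
have h i : \forall s \near t, `|f t ord0 i - f s ord0 i| < e.
  by have /cvgrPdist_lt/(_ e e0) := cf i.
have /filter_forall : forall i, \forall s \near t, `|f t ord0 i - f s ord0 i| <
  e.
  exact: h.
apply: filterS => s hs; rewrite /Num.norm /= mx_normrE.
apply/bigmax_ltP; split => // -[i j] _ /=.
by rewrite ord1 !mxE.
Qed.

Lemma continuous_sum_at (T : topologicalType) (I : Type) (r : seq I)
    (f : I -> T -> R) (t : T) :
  (forall i, {for t, continuous (f i)}) ->
  {for t, continuous (fun s => \sum_(i <- r) f i s)}.
Proof.
move=> cf; elim: r => [|i r IH].
  rewrite (_ : (fun _ => _) = cst 0); first exact: cst_continuous.
  by apply/funext => s; rewrite big_nil.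
rewrite (_ : (fun _ => _) = (fun s => f i s + \sum_(i <- r) f i s)).
  by apply: continuousD => //; exact: cf.
by apply/funext => s; rewrite big_cons.
Qed.

Lemma continuous_dot (T : topologicalType) (f g : T -> 'rV[R]_n) (t : T) :
  {for t, continuous f} -> {for t, continuous g} ->
  {for t, continuous (fun s => dot (f s) (g s))}.
Proof.
move=> cf cg.
rewrite (_ : (fun s => _) = fun s => \sum_i f s ord0 i * g s ord0 i).
  apply: continuous_sum_at => i; apply: continuousM.
    exact: (continuous_comp cf (@coord_continuous _ _ _ _ _ _)).
  exact: (continuous_comp cg (@coord_continuous _ _ _ _ _ _)).
by apply/funext => s; rewrite dotE.
Qed.

Lemma continuous_enorm : continuous (@enorm R n).
Proof.
move=> x; apply: (@continuous_comp _ _ _ (fun y => dot y y) Num.sqrt).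
  by apply: continuous_dot; exact: cvg_id.
exact: sqrt_continuous.
Qed.

Lemma compact_sphere : compact (@sphere R n).
Proof.
apply: bounded_closed_compact; last first.
  rewrite (_ : @sphere R n = @enorm R n @^-1` [set 1])//.
  apply: closed_comp; last exact: closed_eq.
  by move=> x _; exact: continuous_enorm.
exists 1; split => // M M1 x /= x1.
by rewrite (le_trans (norm_le_enorm _))// x1 ltW.
Qed.

End EnormTopology.

Lemma continuous_mulmx (R : realType) (T : topologicalType) n m
    (f : T -> 'rV[R]_n) (A : 'M[R]_(n, m)) (t : T) :
  {for t, continuous f} -> {for t, continuous (fun s => f s *m A)}.
Proof.
move=> cf; apply: continuous_row => i.
rewrite (_ : (fun s => _) = fun s => \sum_j f s ord0 j * A j i); last first.
  by apply/funext => s; rewrite mxE.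
apply: continuous_sum_at => j; apply: continuousM; last exact: cst_continuous.
exact: (continuous_comp cf (@coord_continuous _ _ _ _ _ _)).
Qed.

Section MeasurableContinuous.
Context {R : realType} {n : nat}.

(** Rounding down to the lattice of mesh [1 / (k + 1)]. The composite [h \o grid k] takes countably
    many values on measurable cells, and it converges to [h] at every point of continuity; at [0] it
    converges because [0] rounds to itself. *)
Let grid (k : nat) (x : 'rV[R]_n) : 'rV[R]_n :=
  \row_i ((Num.floor (k.+1%:R * x ord0 i))%:~R / k.+1%:R).

Let grid_dist k x : `|x - grid k x| <= k.+1%:R^-1.
Proof.
rewrite /Num.norm /= mx_normrE; apply/bigmax_leP; split => [|[i j] _ /=].
  by rewrite invr_ge0.
rewrite ord1 !mxE; set y := x _ _.
have k0 : (0 < k.+1%:R :> R) by [].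
have /andP[] := floor_itv (k.+1%:R * y); rewrite intrD.
move=> h1 h2; have -> : y - (Num.floor (k.+1%:R * y))%:~R / k.+1%:R =
    (k.+1%:R * y - (Num.floor (k.+1%:R * y))%:~R) / k.+1%:R.
  by field; rewrite /= addrC natr1 lt0r_neq0.
rewrite normrM [X in _ * X]ger0_norm ?invr_ge0// -[leRHS]mul1r.
by rewrite ler_pM2r ?invr_gt0// ler_norml; apply/andP; split; lra.
Qed.

Let continuous_at_lim_grid (h : 'rV[R]_n -> R) x :
  (x != 0 -> {for x, continuous h}) -> (fun k => h (grid k x)) @ \oo --> h x.
Proof.
have [->|x0] := eqVneq x 0 => ch.
  rewrite (_ : (fun k => _) = cst (h 0)); first exact: cvg_cst.
  apply/funext => k; congr h; apply/rowP => i.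
  by rewrite !mxE mulr0 floor0 mul0r.
apply: (@cvg_comp _ _ _ (grid ^~ x) h _ (nbhs x)); last exact: ch.
apply/cvgrPdist_lt => e e0; near=> k.
apply: (le_lt_trans (grid_dist _ _)); near: k.
by apply: near_infty_natSinv_lt (PosNum e0).
Unshelve. all: by end_near. Qed.

Lemma continuous_off0_measurable (h : 'rV[R]_n -> R) :
  (forall x, x != 0 -> {for x, continuous h}) ->
  measurable_fun setT (fun t : Rtuple R n => h (rv t)).
Proof.
move=> ch; apply: (@measurable_fun_cvg _ _ _ _ (fun k t => h (grid k (rv t)))).
  move=> k _ Y mY; rewrite setTI.
  rewrite (_ : _ @^-1` Y = \bigcup_(z : 'rV[int]_n)
    [set t | Y (h (map_mx (fun m => m%:~R / k.+1%:R) z)) /\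
       forall i, Num.floor (k.+1%:R * (tnth t i : R)) = z ord0 i]).
    apply: countable_bigcupT_measurable => [|z]; first exact: countableP.
    have [hz|hz] := pselect (Y (h (map_mx (fun m => m%:~R / k.+1%:R) z)));
      last first.
      by rewrite (_ : mkset _ = set0)//; apply/seteqP; split => t [].
    rewrite (_ : mkset _ = \bigcap_(i : 'I_n)
      [set t | Num.floor (k.+1%:R * (tnth t i : R)) = z ord0 i]); last first.
      apply/seteqP; split => t /=; first by move=> [_ H] i _; exact: H.
      by move=> H; split => // i; exact: H.
    apply: fin_bigcap_measurable => // i _.
    rewrite (_ : mkset _ = [set: Rtuple R n] `&`
      (fun t : Rtuple R n => (k.+1%:R * (tnth t i : R))) @^-1`
        `[(z ord0 i)%:~R, (z ord0 i + 1)%:~R[%classic).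
      have : measurable_fun setT (fun t : Rtuple R n => (k.+1%:R * (tnth t i :
        R))).
        by apply: measurable_funM => //; exact: measurable_tnth.
      by apply => //; exact: measurable_itv.
    rewrite setTI; apply/seteqP; split => t /=; rewrite in_itv /= -floor_eq.
      by move=> ->.
    by move=> /eqP.
  apply/seteqP; split => t /=.
    move=> Yt; exists (\row_i Num.floor (k.+1%:R * (tnth t i : R))) => //.
    split; last by move=> i; rewrite mxE.
    rewrite (_ : map_mx _ _ = grid k (rv t))//.
    by apply/rowP => i; rewrite !mxE.
  move=> [z _ /= [Yz hz]]; rewrite (_ : grid k (rv t) =
    map_mx (fun m => m%:~R / k.+1%:R) z)//.
  by apply/rowP => i; rewrite !mxE hz.
by move=> t _; apply: continuous_at_lim_grid => t0; exact: ch.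
Qed.

End MeasurableContinuous.

(** Nonnegativity lets Tonelli apply without integrability conditions. A homogeneous function is
    rarely continuous at [0], so its value there is left free, which is why averages use the
    punctured ball. *)
Definition angular (R : realType) n (h : 'rV[R]_n -> R) :=
  [/\ forall c x, 0 < c -> h (c *: x) = h x, forall x, 0 <= h x &
      forall x, x != 0 -> {for x, continuous h}].

Section Angular.
Context {R : realType} {n : nat}.
Implicit Types h k : 'rV[R]_n -> R.

Lemma angular_cst (c : R) : 0 <= c -> angular (fun _ : 'rV[R]_n => c).
Proof. by move=> c0; split => // x _; exact: cst_continuous. Qed.

Lemma angularD h k : angular h -> angular k -> angular (fun x => h x + k x).
Proof.
move=> [hh h0 ch] [hk k0 ck]; split => [c x c0|x|x x0].
- by rewrite hh// hk.
- by rewrite addr_ge0.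
- by apply: continuousD; [exact: ch|exact: ck].
Qed.

Lemma angularM h k : angular h -> angular k -> angular (fun x => h x * k x).
Proof.
move=> [hh h0 ch] [hk k0 ck]; split => [c x c0|x|x x0].
- by rewrite hh// hk.
- by rewrite mulr_ge0.
- by apply: continuousM; [exact: ch|exact: ck].
Qed.

Lemma angularX h p : angular h -> angular (fun x => h x ^+ p).
Proof.
move=> ah; elim: p => [|p IH].
  by under eq_fun do rewrite expr0; exact: angular_cst.
by under eq_fun do rewrite exprS; exact: angularM.
Qed.

Lemma angular_measurable h : angular h ->
  measurable_fun setT (fun t : Rtuple R n => h (rv t)).
Proof. by move=> [_ _ ch]; exact: continuous_off0_measurable. Qed.

Lemma enorm_normalize (x : 'rV[R]_n) : x != 0 -> enorm ((enorm x)^-1 *: x) = 1.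
Proof.
move=> x0; rewrite enormZ ger0_norm ?invr_ge0 ?enorm_ge0//.
by rewrite mulVf// enorm_eq0.
Qed.

Lemma sphere_neq0 (x : 'rV[R]_n) : sphere x -> x != 0.
Proof. by move=> x1; rewrite -enorm_gt0 x1. Qed.

Lemma angular_normalize h x : angular h -> x != 0 ->
  h ((enorm x)^-1 *: x) = h x.
Proof. by move=> [hh _ _] x0; rewrite hh// invr_gt0 enorm_gt0. Qed.

(** Uniform continuity from compactness of the sphere. Only [u] has to be a unit vector: the slab
    estimate compares it with a projection [v] that lies off the sphere. *)
Lemma angular_unif h : angular h -> forall e : R, 0 < e -> exists2 d, 0 < d &
  forall u v, sphere u -> enorm (u - v) < d -> `|h u - h v| < e.
Proof.
move=> [_ _ ch] e e0.
have /compact_near_coveringP := @compact_sphere R n.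
move=> /(_ R (0 : R)^'+ (fun d u => forall v, enorm (u - v) < d -> `|h u - h v|
  < e)).
have hc : forall x, sphere x -> \forall x' \near x & i \near 0^'+,
    forall v, enorm (x' - v) < i -> `|h x' - h v| < e.
  move=> u /sphere_neq0/ch/cvgrPdist_lt/(_ (e / 2)).
  rewrite divr_gt0// => /(_ erefl) /nbhs_ballP[d /= d0 hd].
  have d2 : 0 < d / 2 by rewrite divr_gt0.
  exists (ball u (d / 2), [set i | i < d / 2]) => /=.
    split; first exact: nbhsx_ballx.
    by near=> i => /=; near: i; apply: nbhs_right_lt.
  move=> [u' i] /= [uu' id2] v u'v.
  have hu : ball u d u' by apply: le_ball uu';
    rewrite ler_pdivrMr// ler_pMr// ler1n.
  have hv : ball u d v.
    apply: (@ball_split _ _ u') => //.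
    move: u'v; rewrite -ball_normE /= => u'v.
    exact: (le_lt_trans (norm_le_enorm _) (lt_trans u'v id2)).
  have := ler_distD (h u) (h u') (h v); move=> /le_lt_trans; apply.
  rewrite [e]splitr ltrD//; last exact: hd.
  by rewrite distrC; exact: hd.
move=> /(_ _ hc) => hd.
have [d [d0 Hd]] : exists d, 0 < d /\ forall x, sphere x ->
    forall v, enorm (x - v) < d -> `|h x - h v| < e.
  near (0:R)^'+ => d; exists d; split => //.
  by near: d.
by exists d => // u v Su uv; exact: Hd.
Unshelve. all: by end_near. Qed.

Lemma angular_bounded h : angular h ->
  exists2 M, 0 < M & forall x, h x <= M.
Proof.
move=> ah; have [hh h0 ch] := ah.
have [e [M0]] : exists M, 0 <= M /\ forall x, sphere x -> h x <= M.
  have [S0|/set0P S0] := eqVneq (@sphere R n) set0.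
    by exists 0; split => // x; rewrite S0.
  have [] := @compact_EVT_max _ _ h _ S0 (@compact_sphere R n).
    apply: continuous_in_subspaceT => x /set_mem /sphere_neq0.
    exact: ch.
  move=> c Sc cM; exists (h c); split => // x Sx.
  by apply: cM; exact/mem_set.
(* [h 0] is unrelated to the values on the sphere, so it enters the bound separately. *)
move=> hM; exists (e + h 0 + 1); first by rewrite ltr_wpDl// addr_ge0.
move=> x; have [->|x0] := eqVneq x 0.
  by rewrite addrAC lerDr addr_ge0.
rewrite -(angular_normalize ah x0) (le_trans (hM _ _))//.
  exact: enorm_normalize.
by rewrite -addrA lerDl addr_ge0.
Qed.

End Angular.

Lemma angular_isom (R : realType) n m (h : 'rV[R]_n -> R) (A : 'M[R]_(m, n)) :
  A *m A^T = 1%:M -> angular h -> angular (fun x => h (x *m A)).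
Proof.
move=> AA [hh h0 ch]; split => [c x c0|x|x x0] //.
  by rewrite -scalemxAl hh.
have cA : {for x, continuous (fun y : 'rV[R]_m => y *m A)}.
  by apply: continuous_mulmx; exact: cvg_id.
have xA0 : x *m A != 0 by rewrite -enorm_gt0 enorm_isom// enorm_gt0.
exact: (continuous_comp cA (ch _ xA0)).
Qed.

Section BallAverage.
Context {R : realType}.

Definition pball n (x : 'rV[R]_n) : bool := 0 < enorm x <= 1.

Definition ball_int n (h : 'rV[R]_n -> R) : \bar R :=
  lint (fun x => ((pball x)%:R * h x)%:E).

(** For an angular [h] this is the average over the sphere: [h] is constant along rays, so the
    radial integral cancels in the quotient. In dimension [0] the punctured ball is empty and the
    quotient is [0], hence the dimensions [n.+1] below. *)
Definition ball_avg n (h : 'rV[R]_n -> R) : R :=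
  fine (ball_int h) / fine (ball_int (fun _ : 'rV[R]_n => 1)).

Lemma measurable_pball d (T : measurableType d) n (f : T -> 'rV[R]_n) :
  measurable_row f -> measurable_fun setT (fun t => pball (f t)).
Proof.
move=> mf; apply: measurable_and.
  by apply: measurable_fun_ltr => //; exact: measurable_enorm_row.
by apply: measurable_fun_ler => //; exact: measurable_enorm_row.
Qed.

Lemma borel_ball_int n (h : 'rV[R]_n -> R) : angular h ->
  borel_row (fun x => ((pball x)%:R * h x)%:E).
Proof.
move=> ah; apply/measurable_EFinP; apply: measurable_funM.
  by apply: measurable_indb; apply: measurable_pball; exact: measurable_row_rv.
exact: angular_measurable.
Qed.

(** Dilation by [2] fixes the origin but multiplies measure by [2 ^+ n.+1], and the mass is finite.
    In dimension [0] the point has mass [1]. *)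
Lemma lint_set0 n : lint (fun x : 'rV[R]_n.+1 => (x == 0)%:R%:E) = 0%E.
Proof.
set F := fun x : 'rV[R]_n.+1 => _.
have mF : borel_row F.
  apply/measurable_EFinP; apply: measurable_indb.
  under eq_fun do rewrite -enorm_eq0.
  apply: measurable_fun_eqr => //;
    exact: measurable_enorm_row (@measurable_row_rv R _).
have F0 x : (0 <= F x)%E by exact: ind_ge0.
have lF : (lint F < +oo)%E.
  have /andP[_] := @lint_ball_fin_gt0 R n.+1; apply: le_lt_trans.
  apply: le_lint => //; first exact: borel_ind_ball.
  move=> x; rewrite /F /ind_ball lee_fin ler_nat.
  case: eqP => // ->; rewrite lt0b.
  by have /eqP -> : enorm (0 : 'rV[R]_n.+1) == 0;
    [rewrite enorm_eq0|exact: ler01].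
have := @lint_affine R n.+1 F 2 0 (ltr0n _ _) mF F0.
rewrite (_ : (fun x => _) = F); last first.
  apply/funext => x; rewrite addr0 /F; congr ((nat_of_bool _)%:R%:E).
  by rewrite scaler_eq0 pnatr_eq0.
have fl : lint F \is a fin_num by rewrite ge0_fin_numE// lint_ge0.
rewrite -(fineK fl) -EFinM => -[]; set l := fine _ => h; congr _%:E.
have : (2 ^+ n.+1 - 1) * l = 0 by rewrite mulrBl mul1r -h subrr.
move=> /eqP; rewrite mulf_eq0 => /orP[|/eqP//].
by rewrite subr_eq0 gt_eqF// exprn_egt1// ltr1n.
Qed.

Lemma ball_int1 n : ball_int (fun _ : 'rV[R]_n.+1 => 1) = lint (@ind_ball R
  n.+1).
Proof.
have -> : lint (@ind_ball R n.+1) = (ball_int (fun _ : 'rV[R]_n.+1 => 1%R) +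
    lint (fun x : 'rV[R]_n.+1 => (x == 0)%:R%:E))%E.
  rewrite -ge0_integralD//.
  - apply: eq_integral => t _; rewrite -EFinD mulr1 /ind_ball /pball.
    rewrite enorm_gt0 -enorm_eq0; have [->|_] := eqVneq (enorm _) 0.
      by rewrite /= ler01 add0r.
    by rewrite andTb addr0.
  - by apply: (@borel_ball_int _ (fun=> 1)); exact: angular_cst.
  - apply/measurable_EFinP; apply: measurable_indb.
    under eq_fun do rewrite -enorm_eq0.
    apply: measurable_fun_eqr => //;
      exact: measurable_enorm_row (@measurable_row_rv R _).
by rewrite lint_set0 adde0.
Qed.

Lemma ball_int_ge0 n (h : 'rV[R]_n -> R) : (forall x, 0 <= h x) ->
  (0 <= ball_int h)%E.
Proof. by move=> h0; apply: lint_ge0 => x; rewrite lee_fin mulr_ge0. Qed.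

Lemma ball_intD n (h k : 'rV[R]_n -> R) : angular h -> angular k ->
  ball_int (fun x => h x + k x) = (ball_int h + ball_int k)%E.
Proof.
move=> ah ak; have [_ h0 _] := ah; have [_ k0 _] := ak.
rewrite -ge0_integralD//.
- by apply: eq_integral => t _; rewrite mulrDr EFinD.
- by move=> t _; rewrite lee_fin mulr_ge0.
- exact: borel_ball_int.
- by move=> t _; rewrite lee_fin mulr_ge0.
- exact: borel_ball_int.
Qed.

Lemma ball_intZ n (c : R) (h : 'rV[R]_n -> R) : angular h -> 0 <= c ->
  ball_int (fun x => c * h x) = (c%:E * ball_int h)%E.
Proof.
move=> ah c0; have [_ h0 _] := ah; rewrite -lintZl//.
- by congr lint; apply/funext => x; rewrite mulrCA EFinM.
- exact: borel_ball_int.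
- by move=> x; rewrite lee_fin mulr_ge0.
Qed.

Lemma ball_int_le n (h k : 'rV[R]_n -> R) : angular h -> angular k ->
  (forall x, x != 0 -> h x <= k x) -> (ball_int h <= ball_int k)%E.
Proof.
move=> ah ak hk; have [_ h0 _] := ah; apply: le_lint; try exact: borel_ball_int.
  by move=> x; rewrite lee_fin mulr_ge0.
move=> x; rewrite lee_fin /pball enorm_gt0.
have [->|x0] := eqVneq x 0; first by rewrite !mul0r.
by rewrite ler_wpM2l// hk.
Qed.

Lemma ball_int_fin n (h : 'rV[R]_n -> R) : angular h ->
  ball_int h \is a fin_num.
Proof.
move=> ah; have [_ h0 _] := ah.
rewrite ge0_fin_numE; last exact: ball_int_ge0.
have [M M0 hM] := angular_bounded ah.
have /andP[_ lb] := @lint_ball_fin_gt0 R n.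
apply: (@le_lt_trans _ _ (M%:E * lint (@ind_ball R n))%E); last first.
  by rewrite lte_mul_pinfty// ?lee_fin ltW.
rewrite -lintZl//; last 3 first.
- exact: borel_ind_ball.
- by move=> x; exact: ind_ge0.
- by rewrite lee_fin ltW.
apply: le_lint; first exact: borel_ball_int.
- apply: emeasurable_funM => //; exact: borel_ind_ball.
- by move=> x; rewrite lee_fin mulr_ge0.
move=> x; rewrite /ind_ball /pball -EFinM lee_fin mulrC.
by rewrite ler_pM// ler_nat; case: ltP; case: leP.
Qed.

Lemma eq_ball_int n (h k : 'rV[R]_n -> R) : (forall x, x != 0 -> h x = k x) ->
  ball_int h = ball_int k.
Proof.
move=> hk; congr lint; apply/funext => x; rewrite /pball enorm_gt0.
by have [->|x0] := eqVneq x 0; [rewrite !mul0r|rewrite hk].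
Qed.

Lemma ball_int_isom n (h : 'rV[R]_n -> R) (A : 'M[R]_n) : angular h ->
  A *m A^T = 1%:M -> ball_int (fun x => h (x *m A)) = ball_int h.
Proof.
move=> ah AA; have [_ h0 _] := ah.
rewrite -[RHS](lint_isom AA (borel_ball_int ah)).
  by congr lint; apply/funext => x; rewrite /pball enorm_isom.
by move=> x; rewrite lee_fin mulr_ge0.
Qed.

Lemma fine_ball_int1_gt0 n : 0 < fine (ball_int (fun _ : 'rV[R]_n.+1 => 1)).
Proof. by rewrite ball_int1 fine_gt0// lint_ball_fin_gt0. Qed.

Lemma ball_avgD n (h k : 'rV[R]_n -> R) : angular h -> angular k ->
  ball_avg (fun x => h x + k x) = ball_avg h + ball_avg k.
Proof.
by move=> ah ak; rewrite /ball_avg ball_intD// fineD ?ball_int_fin// mulrDl.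
Qed.

Lemma ball_avgZ n (c : R) (h : 'rV[R]_n -> R) : angular h -> 0 <= c ->
  ball_avg (fun x => c * h x) = c * ball_avg h.
Proof.
by move=> ah c0; rewrite /ball_avg ball_intZ// fineM ?ball_int_fin// mulrA.
Qed.

Lemma ball_avg_le n (h k : 'rV[R]_n -> R) : angular h -> angular k ->
  (forall x, x != 0 -> h x <= k x) -> ball_avg h <= ball_avg k.
Proof.
move=> ah ak hk; rewrite ler_wpM2r// ?invr_ge0 ?fine_ge0 ?ball_int_ge0//.
by apply: fine_le; rewrite ?ball_int_fin// ball_int_le.
Qed.

Lemma ball_avg_ge0 n (h : 'rV[R]_n -> R) : angular h -> 0 <= ball_avg h.
Proof.
by move=> [_ h0 _]; rewrite divr_ge0// fine_ge0// ball_int_ge0.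
Qed.

Lemma eq_ball_avg n (h k : 'rV[R]_n -> R) : (forall x, x != 0 -> h x = k x) ->
  ball_avg h = ball_avg k.
Proof. by move=> hk; rewrite /ball_avg (eq_ball_int hk). Qed.

Lemma ball_avg_cst n (c : R) : 0 <= c -> ball_avg (fun _ : 'rV[R]_n.+1 => c) =
  c.
Proof.
move=> c0; rewrite -[in LHS](mulr1 c) ball_avgZ//; last exact: angular_cst.
by rewrite /ball_avg mulfV ?mulr1// gt_eqF// fine_ball_int1_gt0.
Qed.

Lemma ball_avg_isom n (h : 'rV[R]_n -> R) (A : 'M[R]_n) : angular h ->
  A *m A^T = 1%:M -> ball_avg (fun x => h (x *m A)) = ball_avg h.
Proof. by move=> ah AA; rewrite /ball_avg ball_int_isom. Qed.

End BallAverage.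

(** * Polar coordinates *)

Section PowerIntegrals.
Context {R : realType}.

Lemma continuous_exp_at (T : topologicalType) (f : T -> R) (p : nat) (t : T) :
  {for t, continuous f} -> {for t, continuous (fun s => f s ^+ p)}.
Proof.
move=> cf; elim: p => [|p IH].
  rewrite (_ : (fun s => _) = cst 1); first exact: cst_continuous.
  by apply/funext => s; rewrite expr0.
rewrite (_ : (fun s => _) = (fun s => f s * f s ^+ p));
  first exact: continuousM.
by apply/funext => s; rewrite exprS.
Qed.

Lemma integral_power (n : nat) (a : R) : 0 < a ->
  (\int[@lebesgue_measure R]_(s in `[0%R, a]) (n.+1%:R * s ^+ n)%:E =
   (a ^+ n.+1)%:E)%E.
Proof.
move=> a0; rewrite (@continuous_FTC2 R _ (fun s => s ^+ n.+1)) //.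
- by rewrite expr0n /= sube0.
- apply: continuous_subspaceT => s; apply: cvgM; first exact: cvg_cst.
  exact: exprn_continuous.
- split.
  + move=> s _; exact: exprn_derivable.
  + by apply: cvg_at_right_filter; exact: exprn_continuous.
  + by apply: cvg_at_left_filter; exact: exprn_continuous.
- by move=> s _; rewrite derive1E exp_derive /= scaler1.
Qed.

Lemma integral_inv_power (n : nat) (a : R) : 0 < a ->
  (\int[@lebesgue_measure R]_(s in `[a, +oo[) (n.+1%:R * (s^-1) ^+ n.+2)%:E =
   ((a^-1) ^+ n.+1)%:E)%E.
Proof.
move=> a0.
have cinv s : a <= s -> {for s, continuous (@GRing.inv R)}.
  by move=> as_; apply: inv_continuous; rewrite gt_eqF// (lt_le_trans a0).
have cpow p s : a <= s -> {for s, continuous (fun s : R => s^-1 ^+ p)}.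
  by move=> as_; apply: continuous_exp_at; exact: cinv.
have dF x : a <= x -> is_derive x (1 : R) (fun s => - (s^-1 ^+ n.+1))
    (n.+1%:R * (x^-1) ^+ n.+2).
  move=> ax; have x0 : x != 0 by rewrite gt_eqF// (lt_le_trans a0).
  have h := is_deriveN (is_deriveX n.+1 (is_deriveV (f := id) x0 (is_derive_id
    x 1))).
  have -> : (fun s : R => - (s^-1 ^+ n.+1)) = - ((fun s : R => (id s)^-1) ^+
    n.+1).
    by apply/funext => s; rewrite fctE exprfctE.
  apply: (is_derive_eq h).
  change (- ((n.+1%:R * x^-1 ^+ n) * (- x ^- 2 * 1)) = n.+1%:R * x^-1 ^+ n.+2).
  by rewrite mulr1 mulrN opprK -exprVn -mulrA -exprD addn2.
rewrite (@ge0_continuous_FTC2y R _ (fun s => - (s^-1 ^+ n.+1)) _ 0) //.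
- by rewrite -EFinB opprK add0r.
- move=> x ax; rewrite mulr_ge0// exprn_ge0// invr_ge0.
  exact: le_trans (ltW a0) ax.
- apply: continuous_in_subspaceT => s; rewrite inE /= in_itv /= andbT => as_.
  by apply: cvgM; [exact: cvg_cst|exact: cpow].
- rewrite -oppr0; apply: cvgN.
  have c0 : {for 0, continuous (fun x : R => x ^+ n.+1)}.
    by apply: continuous_exp_at; exact: cvg_id.
  rewrite (_ : 0 = 0 ^+ n.+1 :> R); last by rewrite expr0n.
  apply: (@cvg_comp _ _ _ (fun x : R => x^-1) (fun x => x ^+ n.+1) _ (nbhs 0));
    last exact: c0.
  apply/(gtr0_cvgV0 (f := idfun)); last exact: cvg_id.
  by near=> x; near: x; exact: nbhs_pinfty_gt.
- by move=> x ax; case: (dF x (ltW ax)).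
- by apply: cvg_at_right_filter; apply: cvgN; exact: cpow.
- move=> x; rewrite in_itv /= andbT => ax.
  by rewrite derive1E (@derive_val _ _ _ _ _ _ _ (dF x (ltW ax))).
Unshelve. all: by end_near. Qed.
End PowerIntegrals.

Section Polar.
Context {R : realType} {p : nat}.

Lemma ge0_integral_ind d (T : measurableType d) (mu : {measure set T -> \bar R})
    (b : T -> bool) (f : T -> R) :
  (\int[mu]_t ((b t)%:R * f t)%:E = \int[mu]_(t in [set t | b t]) (f t)%:E)%E.
Proof.
rewrite [RHS]integral_mkcond; apply: eq_integral => t _; rewrite /patch.
have -> : (t \in [set t | b t]) = b t.
  by apply/idP/idP => [/set_mem|bt] //; exact/mem_set.
by case: (b t); rewrite ?mul1r ?mul0r.
Qed.

(** The radial Jacobian in dimension [p.+1], normalized so that []0, a]] has mass [a ^+ p.+1]; the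
    unit interval then has mass [1], and no constant appears in [polar]. *)
Definition polar_density (s : R) : R := (0 < s)%R%:R * (p.+1%:R * s ^+ p).

Lemma polar_density_ge0 s : 0 <= polar_density s.
Proof.
by rewrite /polar_density; case: ltrP => s0;
  rewrite ?mul0r// mul1r mulr_ge0// exprn_ge0// ltW.
Qed.

Lemma measurable_polar_density d (T : measurableType d) (f : T -> R) :
  measurable_fun setT f -> measurable_fun setT (fun t => polar_density (f t)).
Proof.
move=> mf; apply: measurable_funM.
  by apply: measurable_indb; exact: measurable_fun_ltr.
by apply: measurable_funM => //; exact: measurable_funX.
Qed.

Lemma integral_polar_density (a : R) : 0 < a ->
  (\int[@lebesgue_measure R]_s (polar_density s * (s <= a)%R%:R)%:E =
   (a ^+ p.+1)%:E)%E.
Proof.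
move=> a0; rewrite -(integral_power p a0) -integral_itv_obnd_cbnd; last first.
  apply/measurable_EFinP; apply: measurable_funTS.
  by apply: measurable_funM => //; exact: measurable_funX.
rewrite (_ : [set` `]0, a]] = [set s : R | (0 < s) && (s <= a)]).
  rewrite -ge0_integral_ind; apply: eq_integral => s _.
  by congr _%:E; rewrite /polar_density -mulnb natrM; ring.
by apply/seteqP; split => s /=; rewrite in_itv.
Qed.

(* Rescaling [x] by [s] inside the double integral on the right leaves the
   weight [p.+1 s ^- p.+2] on [s >= enorm x], of total mass [enorm x ^- p.+1].
     *)
Lemma polar (F : 'rV[R]_p.+1 -> \bar R) : borel_row F ->
  (forall x, (0 <= F x)%E) ->
  lint (fun x => ((x != 0)%:R%:E * F x)%E) =
  lint (fun x => (((pball x)%:R * enorm x ^+ p.+1)%:E *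
    \int[@lebesgue_measure R]_s ((polar_density s)%:E * F (s *: x)%R))%E).
Proof.
move=> mF F0.
have w0 x : (0 <= ((pball x)%:R * enorm x ^+ p.+1)%:E)%E.
  by rewrite lee_fin mulr_ge0// exprn_ge0// enorm_ge0.
have j0 s : (0 <= (polar_density s)%:E)%E by rewrite lee_fin polar_density_ge0.
have mw d (T : measurableType d) (f : T -> 'rV[R]_p.+1) : measurable_row f ->
    measurable_fun setT (fun t => ((pball (f t))%:R * enorm (f t) ^+ p.+1)%:E).
  move=> mf; apply/measurable_EFinP; apply: measurable_funM.
    by apply: measurable_indb; exact: measurable_pball.
  by apply: measurable_funX; exact: measurable_enorm_row.
(* [G] is the integrand of the right-hand side; for [s > 0], [K s] is [G s] at [s^-1 *: x] times the
   Jacobian [s^-1 ^+ p.+1]. Integrating [K] over [s] first gives the left-hand side. *)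
pose G s x := (((pball x)%:R * enorm x ^+ p.+1)%:E *
  ((polar_density s)%:E * F (s *: x)%R))%E.
pose K s x := (((x != 0)%:R * enorm x ^+ p.+1)%:E * F x *
  ((enorm x <= s)%R%:R * (p.+1%:R * s^-1 ^+ p.+2))%:E)%E.
have mFs d (T : measurableType d) (f : T -> R) (g : T -> 'rV[R]_p.+1) :
    measurable_fun setT f -> measurable_row g ->
    measurable_fun setT (fun t => (polar_density (f t))%:E * F (f t *: g
      t)%R)%E.
  move=> mf mg; apply: emeasurable_funM.
    by apply/measurable_EFinP; exact: measurable_polar_density.
  by apply: (borel_rowP mF); exact: measurable_rowZ.
have mG : measurable_fun setT
    (fun q : measurableTypeR R * Rtuple R p.+1 => G q.1 (rv q.2)).
  apply: emeasurable_funM; first by apply: mw; exact: measurable_row_snd.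
  by apply: mFs => //; exact: measurable_row_snd.
have G0 s x : (0 <= G s x)%E by rewrite !mule_ge0.
have K0 s x : (0 <= K s x)%E.
  rewrite /K !mule_ge0// lee_fin.
    by rewrite mulr_ge0// exprn_ge0// enorm_ge0.
  case: (lerP (enorm x) s) => xs; last by rewrite mul0r.
  by rewrite mul1r mulr_ge0// exprn_ge0// invr_ge0 (le_trans (enorm_ge0 x)).
have mx0 d (T : measurableType d) (f : T -> 'rV[R]_p.+1) : measurable_row f ->
    measurable_fun setT (fun t => ((f t != 0)%:R : R)).
  move=> mf; apply: measurable_indb; under eq_fun do rewrite -enorm_gt0.
  by apply: measurable_fun_ltr => //; exact: measurable_enorm_row.
have mK : measurable_fun setT
    (fun q : measurableTypeR R * Rtuple R p.+1 => K q.1 (rv q.2)).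
  apply: emeasurable_funM; first apply: emeasurable_funM.
  - apply/measurable_EFinP; apply: measurable_funM.
      by apply: mx0; exact: measurable_row_snd.
    by apply: measurable_funX; apply: measurable_enorm_row;
      exact: measurable_row_snd.
  - by apply: (borel_rowP mF); exact: measurable_row_snd.
  - apply/measurable_EFinP; apply: measurable_funM.
      apply: measurable_indb; apply: measurable_fun_ler => //.
      by apply: measurable_enorm_row; exact: measurable_row_snd.
    apply: measurable_funM => //; apply: measurable_funX.
    exact: (measurableT_comp measurable_inv_realType).
transitivity (lint (fun x => \int[@lebesgue_measure R]_s K s x)%E).
  congr lint; apply/funext => x; rewrite /K.
  have [->|x0] := eqVneq x 0.
    by rewrite mul0e integral0_eq// => s _; rewrite mul0r mul0e mul0e.
  have ex : 0 < enorm x by rewrite enorm_gt0.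
  have ms : measurable_fun setT (fun s : R => ((enorm x <= s)%R%:R * (p.+1%:R *
    s^-1 ^+ p.+2))%:E).
    apply/measurable_EFinP; apply: measurable_funM.
      by apply: measurable_indb; apply: measurable_fun_ler.
    apply: measurable_funM => //; apply: measurable_funX.
    exact: measurable_inv_realType.
  rewrite ge0_integralZl//; last first.
  - by rewrite mule_ge0// lee_fin mulr_ge0// exprn_ge0// ltW.
  - move=> s _; rewrite lee_fin; case: (lerP (enorm x) s) => xs; last
    by rewrite mul0r.
    by rewrite mul1r mulr_ge0// exprn_ge0// invr_ge0 (le_trans (ltW ex)).
  rewrite ge0_integral_ind (_ : [set t | _] = [set` `[enorm x, +oo[]);
    last first.
    by apply/seteqP; split => s /=; rewrite in_itv /= andbT.
  rewrite integral_inv_power// muleAC -EFinM !mul1r exprVn mulfV//.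
  by rewrite expf_neq0// gt_eqF.
rewrite -lint_swap1//.
transitivity (\int[@lebesgue_measure R]_s lint (G s))%E; last first.
  rewrite lint_swap1//; congr lint; apply/funext => x.
  rewrite ge0_integralZl//; last by move=> s _; rewrite mule_ge0.
  exact: (mFs _ _ _ _ (@measurable_id _ _ setT) (@measurable_row_cst R _ _ _
    x)).
apply: eq_integral => s _.
(* For [s <= 0] both integrands vanish: the density kills [G], and [enorm x <= s] leaves only
   [x = 0] in [K]. *)
have [s0|s0] := lerP s 0.
  congr lint; apply/funext => x; rewrite /K /G /polar_density.
  rewrite [0 < s]ltNge s0 /= mul0r mul0e mule0.
  have [->|x0] := eqVneq x 0; first by rewrite mul0r !mul0e.
  have /negbTE -> : ~~ (enorm x <= s).
    by rewrite -ltNge (le_lt_trans s0)// enorm_gt0.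
  by rewrite mul0r mule0.
rewrite [RHS](@lint_affine _ _ _ s^-1 0) ?invr_gt0//; last first.
  apply: emeasurable_funM; first by apply: mw; exact: measurable_row_rv.
  by apply: mFs => //; exact: measurable_row_rv.
have mKs : borel_row (fun x => G s (s^-1 *: x + 0)).
  apply: emeasurable_funM.
    apply: mw; apply: measurable_rowD; last exact: measurable_row_cst.
    by apply: measurable_rowZ => //; exact: measurable_row_rv.
  apply: mFs => //; apply: measurable_rowD; last exact: measurable_row_cst.
  by apply: measurable_rowZ => //; exact: measurable_row_rv.
rewrite -lintZl//; last by rewrite lee_fin exprn_ge0// invr_ge0 ltW.
congr lint; apply/funext => x;
  rewrite /K /G addr0 scalerA mulfV ?gt_eqF// scale1r.
rewrite /pball enormZ gtr0_norm ?invr_gt0// /polar_density s0 mul1r.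
rewrite pmulr_rgt0 ?invr_gt0// enorm_gt0 ler_pdivrMl// mulr1.
rewrite -mulnb natrM muleA muleA [RHS]muleAC -!EFinM muleAC -EFinM.
rewrite [LHS]muleAC -EFinM; congr (_%:E * _)%E; rewrite exprMn !exprS !exprVn.
have sp : s ^+ p != 0 by rewrite expf_neq0// gt_eqF.
by field; rewrite sp gt_eqF.
Qed.

End Polar.

Section PolarApplications.
Context {R : realType}.

(** What is used of a Minkowski functional: the star body is the set [N x <= 1]. Without convexity
    the notion passes to hyperplane sections and covers [enorm] as well. *)
Definition gauge n (N : 'rV[R]_n -> R) :=
  [/\ forall c x, 0 < c -> N (c *: x) = c * N x,
      forall x, x != 0 -> 0 < N x &
      forall x, x != 0 -> {for x, continuous N}].

Lemma enorm_gauge n : gauge (@enorm R n).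
Proof.
split => [c x c0|x|x _]; [by rewrite enormZ gtr0_norm|by rewrite enorm_gt0|].
exact: continuous_enorm.
Qed.

Lemma gauge_isom n m (N : 'rV[R]_n -> R) (A : 'M[R]_(m, n)) :
  A *m A^T = 1%:M -> gauge N -> gauge (fun x => N (x *m A)).
Proof.
move=> AA [hN pN cN].
have nz (x : 'rV[R]_m) : x != 0 -> x *m A != 0.
  by rewrite -!enorm_gt0 enorm_isom.
split => [c x c0|x /nz|x /nz x0]; [by rewrite -scalemxAl hN|exact: pN|].
have cA : {for x, continuous (fun y : 'rV[R]_m => y *m A)}.
  by apply: continuous_mulmx; exact: cvg_id.
exact: (continuous_comp cA (cN _ x0)).
Qed.

(** The radial function on the sphere; the factor [enorm x] makes its extension 0-homogeneous. *)
Definition gauge_ratio n (N : 'rV[R]_n -> R) (x : 'rV[R]_n) : R := enorm x / N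
  x.

Lemma angular_gauge_ratio n (N : 'rV[R]_n -> R) : gauge N -> angular
  (gauge_ratio N).
Proof.
move=> [hN pN cN]; split => [c x c0|x|x x0].
- by rewrite /gauge_ratio hN// enormZ gtr0_norm// -mulf_div divff ?mul1r//
  gt_eqF.
- have [->|x0] := eqVneq x 0.
    have /eqP : enorm (0 : 'rV[R]_n) == 0 by rewrite enorm_eq0.
    by rewrite /gauge_ratio => ->; rewrite mul0r.
  by rewrite divr_ge0 ?enorm_ge0// ltW// pN.
- apply: continuousM; first exact: continuous_enorm.
  by apply: continuousV; [rewrite gt_eqF// pN|exact: cN].
Qed.

Lemma gauge_measurable n (N : 'rV[R]_n -> R) : gauge N ->
  measurable_fun setT (fun t : Rtuple R n => N (rv t)).
Proof. by move=> [_ _ cN]; exact: continuous_off0_measurable. Qed.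

Lemma lintD n (F G : 'rV[R]_n -> \bar R) : borel_row F -> borel_row G ->
  (forall x, (0 <= F x)%E) -> (forall x, (0 <= G x)%E) ->
  (lint (fun x => F x + G x) = lint F + lint G)%E.
Proof. by move=> mF mG F0 G0; exact: ge0_integralD. Qed.

(** The ray through [x] stays in the body for [0 < s <= (N x)^-1], an interval of polar mass
    [(N x)^-1 ^+ p.+1]; the weight of [polar] supplies the numerator. *)
Lemma lint_gauge p (N : 'rV[R]_p.+1 -> R) : gauge N ->
  lint (fun x => (N x <= 1)%R%:R%:E) = ball_int (fun x => gauge_ratio N x ^+
    p.+1).
Proof.
move=> gN; have [hN pN cN] := gN.
have mF : borel_row (fun x => (N x <= 1)%R%:R%:E).
  apply/measurable_EFinP; apply: measurable_indb.
  by apply: measurable_fun_ler => //; exact: gauge_measurable.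
(* [polar] sees only the punctured space; the origin is a null set. *)
transitivity (lint (fun x : 'rV[R]_p.+1 => ((x != 0)%:R%:E * (N x <=
  1)%R%:R%:E)%E)).
  have m0 : measurable_fun setT (fun t : Rtuple R p.+1 => ((rv t == 0)%:R)%:E :
    \bar R).
    apply/measurable_EFinP; apply: measurable_indb.
    under eq_fun do rewrite -enorm_eq0.
    by apply: measurable_fun_eqr => //;
      exact: measurable_enorm_row (@measurable_row_rv R _).
  have m1 : measurable_fun setT (fun t : Rtuple R p.+1 => ((rv t != 0)%:R)%:E :
    \bar R).
    apply/measurable_EFinP; apply: measurable_indb.
    under eq_fun do rewrite -enorm_gt0.
    by apply: measurable_fun_ltr => //;
      exact: measurable_enorm_row (@measurable_row_rv R _).
  have mP : borel_row (fun x : 'rV[R]_p.+1 => ((x != 0)%:R%:E * (N x <=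
    1)%R%:R%:E)%E).
    exact: emeasurable_funM.
  have P0 x : (0 <= (x != 0)%:R%:E * (N x <= 1)%R%:R%:E)%E.
    by rewrite mule_ge0 ?ind_ge0.
  have N0 x : (0 <= (N x <= 1)%R%:R%:E :> \bar R)%E by exact: ind_ge0.
  have Z0 (x : 'rV[R]_p.+1) : (0 <= (x == 0)%:R%:E :> \bar R)%E
    by exact: ind_ge0.
  apply/eqP; rewrite eq_le; apply/andP; split.
    rewrite -[leRHS]adde0 -(@lint_set0 R p) -lintD//.
    apply: le_lint => //; first exact: emeasurable_funD.
    move=> x; rewrite -EFinM -EFinD lee_fin.
    by case: (x == 0); case: (N x <= 1);
      rewrite /= ?mul0r ?mul1r ?add0r ?addr0 ?ler01.
  apply: le_lint => // x.
  by rewrite -EFinM lee_fin ler_piMl//; case: (x == 0).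
rewrite polar//.
congr lint; apply/funext => x; rewrite /pball enorm_gt0.
have [->|x0] := eqVneq x 0; first by rewrite /= !mul0r mul0e.
have Nx := pN _ x0.
have NV : 0 < (N x)^-1 by rewrite invr_gt0.
rewrite (_ : (\int[_]_s _ = ((N x)^-1 ^+ p.+1)%:E)%E).
  by rewrite -EFinM -mulrA exprMn.
rewrite -integral_polar_density//; apply: eq_integral => s _.
rewrite -EFinM; congr _%:E; rewrite /polar_density.
have [s0|s0] := ltrP 0 s; last by rewrite !mul0r.
by rewrite hN// -[in RHS]div1r ler_pdivlMr.
Qed.

(** Separates direction from radius. It serves for the slices of a slab, whose indicators depend on
    the norm only. *)
Lemma lint_radial p (k : 'rV[R]_p.+1 -> R) (phi : R -> R) : angular k ->
  measurable_fun setT phi -> (forall r, 0 <= phi r) ->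
  lint (fun x => ((x != 0)%:R * (k x * phi (enorm x)))%:E) =
  (ball_int k * \int[@lebesgue_measure R]_s (@polar_density R p s * phi
    s)%:E)%E.
Proof.
move=> ak mphi phi0; have [hk k0 _] := ak.
have mF : borel_row (fun x : 'rV[R]_p.+1 => (k x * phi (enorm x))%:E).
  apply/measurable_EFinP; apply: measurable_funM;
    first exact: angular_measurable.
  by apply: measurableT_comp => //;
    exact: measurable_enorm_row (@measurable_row_rv R _).
have mjp : measurable_fun setT (fun s : R => (@polar_density R p s * phi s)%:E).
  by apply/measurable_EFinP; apply: measurable_funM => //;
    exact: measurable_polar_density.
have j0 s : 0 <= @polar_density R p s * phi s
  by rewrite mulr_ge0// polar_density_ge0.
under [X in lint X]eq_fun do rewrite EFinM.
rewrite polar//; last by move=> x; rewrite lee_fin mulr_ge0.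
rewrite -lintZr//; last first.
- by apply: integral_ge0 => s _; rewrite lee_fin.
- by move=> x; rewrite lee_fin mulr_ge0.
- exact: borel_ball_int.
congr lint; apply/funext => x; rewrite /pball enorm_gt0.
have [->|x0] := eqVneq x 0; first by rewrite /= !mul0r !mul0e.
have ex : 0 < enorm x by rewrite enorm_gt0.
(* At parameter [s] the point [s *: x] has norm [s * enorm x], so the radius is rescaled to
   match. *)
rewrite [in RHS](@integral_affine _ _ (enorm x) 0)//.
suff -> : (\int[@lebesgue_measure R]_s
    ((@polar_density R p s)%:E * (k (s *: x) * phi (enorm (s *: x)))%:E) =
  ((k x)%:E * ((enorm x)^-1 ^+ p)%:E *
    \int[@lebesgue_measure R]_s ((@polar_density R p (enorm x * s + 0)) *
      phi (enorm x * s + 0))%:E))%E.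
  rewrite !muleA -!EFinM; congr (_%:E * _)%E.
  by rewrite exprS exprVn; field; rewrite expf_neq0// gt_eqF.
rewrite -EFinM -ge0_integralZl//; last first.
- by rewrite lee_fin mulr_ge0// exprn_ge0// invr_ge0 ltW.
- by move=> s _; rewrite lee_fin.
- have ma : measurable_fun setT (fun s : R => enorm x * s + 0).
    by apply: measurable_funD => //; exact: measurable_funM.
  exact: (measurableT_comp mjp ma).
apply: eq_integral => s _; rewrite -!EFinM addr0; congr _%:E.
rewrite /polar_density pmulr_rgt0//; have [s0|s0] := ltrP 0 s; last
  by rewrite !(mul0r, mulr0).
rewrite hk// enormZ gtr0_norm// [s * enorm x]mulrC exprMn exprVn.
by field; rewrite expf_neq0// gt_eqF.
Qed.

Lemma volE n (b : 'rV[R]_n -> bool) :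
  measurable_fun setT (fun t : Rtuple R n => b (rv t)) ->
  vol [set x | b x] = fine (lint (fun x => (b x)%:R%:E)).
Proof.
move=> mb; rewrite /vol /lint; congr fine.
have mB : measurable (@rv R n @^-1` [set x | b x]).
  rewrite -[X in measurable X]setTI.
  by rewrite (_ : _ @^-1` _ = (fun t : Rtuple R n => b (rv t)) @^-1` [set
    true])//; exact: mb.
rewrite -[LHS]mul1e -[LHS]integral_cst//.
rewrite integral_mkcond; apply: eq_integral => t _; rewrite /patch.
have -> : (t \in @rv R n @^-1` [set x | b x]) = b (rv t).
  by apply/idP/idP => [/set_mem|bt] //; exact/mem_set.
by case: (b _).
Qed.

Lemma vol_gauge p (N : 'rV[R]_p.+1 -> R) : gauge N ->
  vol [set x | N x <= 1] = fine (ball_int (fun x => gauge_ratio N x ^+ p.+1)).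
Proof.
move=> gN; rewrite -lint_gauge// volE//.
by apply: measurable_fun_ler => //; exact: gauge_measurable.
Qed.

Lemma vol_ball2 p : vol (@ball2 R p.+1) = fine (ball_int (fun _ : 'rV[R]_p.+1
  => 1)).
Proof.
rewrite ball_int1 [LHS]volE//.
by apply: measurable_fun_ler => //;
  exact: measurable_enorm_row (@measurable_row_rv R _).
Qed.

Lemma vol_ball2_gt0 p : 0 < vol (@ball2 R p.+1).
Proof. by rewrite vol_ball2 fine_ball_int1_gt0. Qed.

Lemma fine_ball_int p (h : 'rV[R]_p.+1 -> R) :
  fine (ball_int h) = vol (@ball2 R p.+1) * ball_avg h.
Proof.
rewrite vol_ball2 /ball_avg mulrCA mulfV ?mulr1// gt_eqF//.
exact: fine_ball_int1_gt0.
Qed.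

End PolarApplications.

(** * The spherical Radon transform *)

Section CauchySchwarz.
Context {R : realType} {n : nat}.
Implicit Types x y : 'rV[R]_n.

Lemma dot_le_enorm x y : `|dot x y| <= enorm x * enorm y.
Proof.
have main (u v : 'rV[R]_n) : dot u v <= enorm u * enorm v.
  have [->|u0] := eqVneq u 0.
    by rewrite -(scale0r 0) dotZl enormZ normr0 !mul0r.
  have [->|v0] := eqVneq v 0.
    by rewrite -(scale0r 0) dotZr enormZ normr0 !(mulr0, mul0r).
  have := dot_ge0 (enorm v *: u - enorm u *: v).
  rewrite dotDl !dotDr !dotNl !dotNr !dotZl !dotZr -!enorm_sqr (dotC v u).
  rewrite -enorm_gt0 in u0; rewrite -enorm_gt0 in v0.
  move: (enorm u) (enorm v) (dot u v) u0 v0 => a b c a0 b0 h.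
  have ab : 0 < a * b by exact: mulr_gt0.
  rewrite -(ler_pM2l ab); nra.
rewrite ler_norml main andbT -[leRHS]opprK lerN2.
by have := main (- x) y; rewrite dotNl enormN.
Qed.

Lemma enormD x y : enorm (x + y) <= enorm x + enorm y.
Proof.
rewrite -(@ler_pXn2r _ 2)// ?nnegrE ?addr_ge0 ?enorm_ge0//.
rewrite enorm_sqr dotDl !dotDr -!enorm_sqr (dotC y x).
have := le_trans (ler_norm _) (dot_le_enorm x y).
by move: (enorm x) (enorm y) (dot x y) => a b c; nra.
Qed.

End CauchySchwarz.

Section Frames.
Context {R : realType} {m : nat}.
Implicit Types (xi : 'rV[R]_m.+1) (E : 'M[R]_(m, m.+1)).

Lemma sphere_dot (x : 'rV[R]_m.+1) : sphere x -> dot x x = 1.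
Proof. by move=> x1; rewrite -enorm_sqr x1 expr1n. Qed.

Lemma perp_frameP xi : sphere xi -> is_perp_frame xi (perp_frame xi).
Proof. by move=> /is_perp_frame_ex [E HE]; rewrite /perp_frame;
  exact: (xgetPex 0 (ex_intro _ E HE)). Qed.

Lemma frame_col_isom xi E : sphere xi -> is_perp_frame xi E ->
  (col_mx xi E : 'M[R]_m.+1) *m (col_mx xi E : 'M[R]_m.+1)^T = 1%:M.
Proof.
move=> xi1 [EE Exi].
have := @tr_col_mx R 1 m m.+1 xi E => ->.
rewrite (mul_col_row xi E xi^T E^T) Exi EE.
have -> : xi *m E^T = 0 by rewrite -[xi]trmxK -trmx_mul Exi trmx0.
have -> : xi *m xi^T = 1%:M.
  by rewrite [LHS]mx11_scalar; congr _%:M; exact: sphere_dot.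
exact/esym/(@scalar_mx_block R 1 m 1).
Qed.

(** An orthogonal matrix has orthonormal columns as well as rows; hence [E^T *m E] is the orthogonal
    projection onto [xi^perp]. *)
Lemma frame_compl xi E : sphere xi -> is_perp_frame xi E ->
  E^T *m E = 1%:M - xi^T *m xi.
Proof.
move=> xi1 HE; have /mulmx1C := frame_col_isom xi1 HE.
have := @tr_col_mx R 1 m m.+1 xi E => ->.
rewrite (mul_row_col xi^T E^T xi E) => <-.
by rewrite addrC addKr.
Qed.

Lemma cons_row_frame s (y : 'rV[R]_m) xi E :
  cons_row s y *m (col_mx xi E : 'M[R]_m.+1) = s *: xi + y *m E.
Proof. by rewrite /cons_row (mul_row_col (s%:M : 'M[R]_1) y xi E)
  mul_scalar_mx. Qed.

Lemma dot_frame s (y : 'rV[R]_m) xi E : sphere xi -> is_perp_frame xi E ->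
  dot xi (cons_row s y *m (col_mx xi E : 'M[R]_m.+1)) = s.
Proof.
move=> xi1 [_ Exi]; rewrite cons_row_frame dotDr dotZr sphere_dot// mulr1.
by rewrite dotC /dot -mulmxA Exi mulmx0 mxE addr0.
Qed.

Definition section_avg (h : 'rV[R]_m.+1 -> R) xi : R :=
  ball_avg (fun y : 'rV[R]_m => h (y *m perp_frame xi)).

(** Two frames of one hyperplane differ by an orthogonal matrix, here [Q]. This allows a frame
    adapted to the estimate at hand in place of the arbitrary [perp_frame]. *)
Lemma section_avg_frame h xi E : sphere xi -> is_perp_frame xi E ->
  angular h -> section_avg h xi = ball_avg (fun y : 'rV[R]_m => h (y *m E)).
Proof.
move=> xi1 HE ah; have HP := perp_frameP xi1.
have [EE Exi] := HE; have [PP Pxi] := HP.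
pose Q := perp_frame xi *m E^T.
have QE : Q *m E = perp_frame xi.
  rewrite -mulmxA (frame_compl xi1 HE) mulmxBr mulmx1 mulmxA Pxi mul0mx.
  by rewrite subr0.
have QQ : Q *m Q^T = 1%:M.
  by rewrite trmx_mul trmxK mulmxA QE PP.
rewrite -(ball_avg_isom (angular_isom EE ah) QQ).
by congr ball_avg; apply/funext => y; rewrite -mulmxA QE.
Qed.

(* The reflection in the hyperplane orthogonal to [xi + eta] maps [eta] to
   [- xi], hence the hyperplane [xi^perp] to [eta^perp], and moves the points of
   [xi^perp] by at most twice the distance from [xi] to [eta]. *)
Lemma close_frame xi eta E : sphere xi -> sphere eta -> is_perp_frame xi E ->
  enorm (xi - eta) <= 1 -> exists2 E', is_perp_frame eta E' &
    forall y, enorm (y *m E - y *m E') <= 2 * enorm y * enorm (xi - eta).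
Proof.
move=> xi1 eta1 [EE Exi] close.
pose w := xi + eta; pose ww := dot w w.
have d1 := sphere_dot xi1; have d2 := sphere_dot eta1.
have wwE : ww = 2 + 2 * dot xi eta.
  by rewrite /ww /w dotDl !dotDr d1 d2 (dotC eta xi); ring.
(* Closeness keeps [xi + eta] away from [0], so the reflection is defined with a bounded
   constant. *)
have ww1 : 1 <= ww.
  have : enorm (xi - eta) ^+ 2 <= 1 by rewrite expr_le1// enorm_ge0.
  rewrite enorm_sqr dotDl !dotDr !dotNl !dotNr d1 d2 (dotC eta xi) wwE.
  by lra.
have ww0 : ww != 0 by rewrite gt_eqF// (lt_le_trans ltr01).
pose c := 2 / ww.
pose H : 'M[R]_m.+1 := 1%:M - c *: (w^T *m w).
have sc (x y : 'rV[R]_m.+1) : x *m y^T = (dot x y)%:M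
  by rewrite [LHS]mx11_scalar.
have HT : H^T = H by rewrite /H linearB /= trmx1 linearZ /= trmx_mul trmxK.
have HH : H *m H = 1%:M.
  rewrite /H mulmxBl mul1mx mulmxBr mulmx1 -scalemxAl -scalemxAr.
  rewrite mulmxA -(mulmxA w^T w) sc mul_mx_scalar -scalemxAl !scalerA.
  rewrite (_ : c * (c * dot w w) = c + c); last first.
    by rewrite /c -/ww; field.
  by rewrite scalerDl opprB addrK subrK.
have Heta : H *m eta^T = - xi^T.
  rewrite /H mulmxBl mul1mx -scalemxAl -mulmxA sc mul_mx_scalar scalerA.
  rewrite (_ : c * dot w eta = 1); last first.
    have -> : dot w eta = ww / 2 by rewrite wwE /w dotDl d2; field.
    by rewrite /c; field.
  by rewrite scale1r /w linearD /= opprD addrCA subrr addr0.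
exists (E *m H).
  split; first by rewrite trmx_mul HT mulmxA -(mulmxA E) HH mulmx1.
  by rewrite -mulmxA Heta mulmxN Exi oppr0.
move=> y; set z := y *m E.
have zH : y *m (E *m H) = z - (c * dot z w) *: w.
  rewrite mulmxA -/z /H mulmxBr mulmx1 -scalemxAr mulmxA sc.
  by rewrite mul_scalar_mx scalerA.
rewrite zH opprB addrC subrK enormZ.
have zxi : dot z xi = 0 by rewrite /dot /z -mulmxA Exi mulmx0 mxE.
(* Since [z] is orthogonal to [xi], its product with [w] is that with [eta]; this is where the
   factor [enorm (xi - eta)] arises. *)
have -> : dot z w = - dot z (xi - eta).
  by rewrite /w !dotDr dotNr zxi; ring.
have ez : enorm z = enorm y by rewrite enorm_isom.
have cs := dot_le_enorm z (xi - eta); rewrite ez in cs.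
have ew : enorm w ^+ 2 = ww by rewrite enorm_sqr.
have ew1 : 1 <= enorm w by rewrite -(@expr_ge1 _ 2) ?enorm_ge0// ew.
rewrite mulrN normrN normrM.
have -> : `|c| = 2 / ww by rewrite ger0_norm// divr_ge0// (le_trans ler01).
have w0 : 0 < enorm w by exact: lt_le_trans ew1.
rewrite -ew -/w; have -> : 2 / enorm w ^+ 2 * `|dot z (xi - eta)| * enorm w =
    2 * `|dot z (xi - eta)| / enorm w by field; rewrite gt_eqF.
rewrite ler_pdivrMr// -!mulrA ler_pM2l// mulrA (le_trans cs)//.
by rewrite ler_peMr// mulr_ge0// enorm_ge0.
Qed.

End Frames.

Lemma continuous_at_dist (R : realType) (T : topologicalType) (f : T -> R) (x :
  T) :
  (forall e, 0 < e -> \forall y \near x, `|f x - f y| <= e) ->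
  {for x, continuous f}.
Proof. by move=> h; apply/cvgrPdist_le. Qed.

Lemma continuous_at_lt (R : realType) (T : topologicalType) (f : T -> R) (x : T)
    (c : R) : {for x, continuous f} -> f x < c -> \forall y \near x, f y < c.
Proof. by move=> cf fxc; exact: (cvgr_lt _ cf). Qed.

Lemma continuous_at_gt (R : realType) (T : topologicalType) (f : T -> R) (x : T)
    (c : R) : {for x, continuous f} -> c < f x -> \forall y \near x, c < f y.
Proof. by move=> cf fxc; exact: (cvgr_gt _ cf). Qed.

Section Radon.
Context {R : realType} {p : nat}.
Implicit Types h k : 'rV[R]_p.+2 -> R.

(** One-sided, because [xi] and [eta] can be exchanged. *)
Lemma section_avg_unif h : angular h -> forall e : R, 0 < e ->
  exists2 d, 0 < d & forall xi eta, sphere xi -> sphere eta ->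
    enorm (xi - eta) < d -> section_avg h eta <= section_avg h xi + e.
Proof.
move=> ah e e0; have [d d0 hd] := angular_unif ah e0.
(* [1] is the closeness required by [close_frame]; [d / 2] absorbs the factor [2] in its bound. *)
exists (Num.min 1 (d / 2)); first by rewrite lt_min ltr01 divr_gt0.
move=> xi eta xi1 eta1; rewrite lt_min => /andP[close1 close2].
have HE := perp_frameP xi1; have [EE Exi] := HE.
have [E' HE' hE'] := close_frame xi1 eta1 HE (ltW close1).
rewrite (section_avg_frame eta1 HE' ah).
have aE := angular_isom EE ah; have [E'E' _] := HE'.
rewrite -[X in _ + X](@ball_avg_cst R p e (ltW e0)) -ball_avgD//; last first.
  by apply: angular_cst; exact: ltW.
apply: ball_avg_le; first exact: angular_isom.
  by apply: angularD => //; apply: angular_cst; exact: ltW.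
move=> y y0; have [hh _ _] := ah.
have ey : 0 < (enorm y)^-1 by rewrite invr_gt0 enorm_gt0.
rewrite -lerBlDl -(hh _ (y *m E') ey) -(hh _ (y *m perp_frame xi) ey).
apply: ltW; apply: le_lt_trans (ler_norm _) _; rewrite distrC; apply: hd.
  by rewrite /sphere /= enormZ gtr0_norm// enorm_isom// mulVf// enorm_eq0.
rewrite -scalerBr enormZ gtr0_norm// mulrC ltr_pdivrMr ?enorm_gt0//.
apply: le_lt_trans (hE' y) _.
by rewrite mulrAC ltr_pM2r ?enorm_gt0//; lra.
Qed.

Definition radon h (x : 'rV[R]_p.+2) : R := section_avg h ((enorm x)^-1 *: x).

Lemma radon_sphere h xi : sphere xi -> radon h xi = section_avg h xi.
Proof. by move=> xi1; rewrite /radon xi1 invr1 scale1r. Qed.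

Lemma section_avg_ge0 h xi : angular h -> sphere xi -> 0 <= section_avg h xi.
Proof.
move=> ah xi1; apply: ball_avg_ge0; apply: angular_isom => //.
by have [] := perp_frameP xi1.
Qed.

Lemma continuous_normalize (x : 'rV[R]_p.+2) : x != 0 ->
  {for x, continuous (fun y : 'rV[R]_p.+2 => (enorm y)^-1 *: y)}.
Proof.
move=> x0; apply: continuousZ; last exact: cvg_id.
by apply: continuousV; [rewrite enorm_eq0|exact: continuous_enorm].
Qed.

Lemma angular_radon h : angular h -> angular (radon h).
Proof.
move=> ah; split => [c x c0|x|x x0].
- rewrite /radon enormZ (gtr0_norm c0); congr (section_avg h _).
  rewrite scalerA; congr (_ *: _).
  have c1 : c^-1 * c = 1 by rewrite mulVf// gt_eqF.
  by rewrite invfM mulrAC c1 mul1r.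
- have [->|x0] := eqVneq x 0; last first.
    by apply: section_avg_ge0 => //; exact: enorm_normalize.
  rewrite divr_ge0// fine_ge0// ball_int_ge0// => y.
  by have [_ + _] := ah; exact.
apply: continuous_at_dist => e e0.
have [d d0 hd] := section_avg_unif ah e0.
have cu : {for x, continuous (fun y : 'rV[R]_p.+2 =>
    enorm ((enorm x)^-1 *: x - (enorm y)^-1 *: y))}.
  have c1 : {for x, continuous (fun y : 'rV[R]_p.+2 =>
      (enorm x)^-1 *: x - (enorm y)^-1 *: y)}.
    by apply: continuousB; [exact: cst_continuous|exact: continuous_normalize].
  exact: (continuous_comp c1 (@continuous_enorm _ _ _)).
have n1 : \forall y \near x, enorm ((enorm x)^-1 *: x - (enorm y)^-1 *: y) < d.
  apply: (continuous_at_lt cu); rewrite subrr.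
  by have /eqP -> : enorm (0 : 'rV[R]_p.+2) == 0 by rewrite enorm_eq0.
have n2 : \forall y \near x, 0 < enorm y.
  by apply: (continuous_at_gt (@continuous_enorm _ _ x)); rewrite enorm_gt0.
near=> y.
have y0 : y != 0 by rewrite -enorm_gt0; near: y.
have yd : enorm ((enorm x)^-1 *: x - (enorm y)^-1 *: y) < d by near: y.
have s1 := enorm_normalize x0; have s2 := enorm_normalize y0.
rewrite /radon ler_distl; apply/andP; split.
  by rewrite lerBlDr; exact: hd.
by apply: hd => //; rewrite -enormN opprB.
Unshelve. all: by end_near. Qed.

Lemma radon_le h (M : R) : angular h ->
  (forall xi, sphere xi -> section_avg h xi <= M) ->
  forall x, x != 0 -> radon h x <= M.
Proof. by move=> ah hM x x0; apply: hM; exact: enorm_normalize. Qed.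

End Radon.

(** * Hyperplane averages as limits of slab averages *)

Section SlabAverages.
Context {R : realType} {p : nat}.
Implicit Types h k : 'rV[R]_p.+2 -> R.

Lemma angular_measurable_row d (T : measurableType d) n (h : 'rV[R]_n -> R)
    (f : T -> 'rV[R]_n) : angular h -> measurable_row f ->
  measurable_fun setT (fun t => h (f t)).
Proof.
move=> ah mf; apply/measurable_EFinP.
apply: (@borel_rowP _ _ _ _ (EFin \o h)) => //.
by apply/measurable_EFinP; exact: angular_measurable.
Qed.

Definition tail_row (z : 'rV[R]_p.+2) : 'rV[R]_p.+1 :=
  \row_i z ord0 (lift ord0 i).

Lemma tail_cons_row s (y : 'rV[R]_p.+1) : tail_row (cons_row s y) = y.
Proof. by apply/rowP => i; rewrite mxE cons_row_lift. Qed.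

Lemma cons_row_tail (z : 'rV[R]_p.+2) : cons_row (z ord0 ord0) (tail_row z) = z.
Proof.
apply/rowP => i; case: (unliftP ord0 i) => [j|] ->.
  by rewrite cons_row_lift mxE.
by rewrite cons_row0.
Qed.

Lemma measurable_tail_row d (T : measurableType d) (f : T -> 'rV[R]_p.+2) :
  measurable_row f -> measurable_row (fun t => tail_row (f t)).
Proof. by move=> mf i; under eq_fun do rewrite mxE; exact: mf. Qed.

Lemma enorm_cons s (y : 'rV[R]_p.+1) :
  enorm (cons_row s y) = Num.sqrt (s ^+ 2 + enorm y ^+ 2).
Proof.
rewrite enorm_sqr /enorm !dotE big_ord_recl cons_row0 expr2.
by congr (Num.sqrt (_ + _)); apply: eq_bigr => i _; rewrite cons_row_lift.
Qed.

(** The thickness is relative to [enorm z]: the condition concerns directions only, and for a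
    general normal [x] it reads [|dot x y| <= e * (enorm x * enorm y)], symmetric in [x] and [y]. *)
Definition slab (e : R) (z : 'rV[R]_p.+2) : bool :=
  pball z && (`|z ord0 ord0| <= e * enorm z).

Definition slab_vol (e : R) : \bar R := lint (fun z => (slab e z)%:R%:E).

Lemma measurable_slab e d (T : measurableType d) (f : T -> 'rV[R]_p.+2) :
  measurable_row f -> measurable_fun setT (fun t => (slab e (f t))%:R : R).
Proof.
move=> mf; apply: measurable_indb; apply: measurable_and.
  exact: measurable_pball.
apply: measurable_fun_ler; first by apply: measurableT_comp => //; exact: mf.
by apply: measurable_funM => //; exact: measurable_enorm_row.
Qed.

Lemma slab_vol_fin e : slab_vol e \is a fin_num.
Proof.
rewrite ge0_fin_numE; last by apply: lint_ge0 => z; exact: ind_ge0.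
have /andP[_] := @lint_ball_fin_gt0 R p.+2; apply: le_lt_trans.
apply: le_lint; last 2 first.
- by move=> z; exact: ind_ge0.
- move=> z; rewrite lee_fin ler_nat /slab /pball.
  by case: (0 < _) => //=; case: (_ <= 1) => //; case: (_ <= _).
- by apply/measurable_EFinP; exact: measurable_slab (@measurable_row_rv R _).
- exact: borel_ind_ball.
Qed.

(* The ball of radius [e / 4] around a point of norm [1 / 2] in the hyperplane
   lies in the slab. *)
Lemma slab_vol_gt0 e : 0 < e < 1 -> (0 < slab_vol e)%E.
Proof.
move=> /andP[e0 e1].
pose v : 'rV[R]_p.+2 := cons_row 0 (2^-1 *: delta_mx ord0 ord0).
have v1 : enorm v = 2^-1.
  rewrite enorm_cons expr0n /= add0r sqrtr_sqr ger0_norm ?enorm_ge0//.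
  rewrite enormZ ger0_norm ?invr_ge0// /enorm dotE (bigD1 ord0)//= big1.
    by rewrite mxE !eqxx addr0 mulr1 sqrtr1 mulr1.
  by move=> i i0; rewrite mxE (negbTE i0) andbF mul0r.
pose F (z : 'rV[R]_p.+2) : \bar R := (enorm (z - v) <= e / 4)%R%:R%:E.
have mF : borel_row F.
  apply/measurable_EFinP; apply: measurable_indb;
    apply: measurable_fun_ler => //.
  apply: measurable_enorm_row; apply: measurable_rowD.
    exact: measurable_row_rv.
  exact: measurable_row_cst.
have F0 x : (0 <= F x)%E by exact: ind_ge0.
have e4 : 0 < e / 4 by rewrite divr_gt0.
apply: (@lt_le_trans _ _ (lint F)).
  rewrite (@lint_affine _ _ _ (e / 4) v)// (_ : (fun x => _) = @ind_ball R
    p.+2).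
    by rewrite mule_gt0// ?lte_fin ?exprn_gt0//;
      case/andP: (@lint_ball_fin_gt0 R p.+2).
  apply/funext => x; rewrite /F /ind_ball addrK enormZ gtr0_norm//.
  by rewrite -[X in _ <= X](mulr1 (e / 4)) ler_pM2l.
apply: le_lint => //.
  by apply/measurable_EFinP; exact: measurable_slab (@measurable_row_rv R _).
move=> z; rewrite lee_fin ler_nat; case: lerP => // zv; rewrite lt0b.
have z0 : `|z ord0 ord0| <= e / 4.
  apply: le_trans zv; apply: le_trans (coord_le_enorm _ ord0).
  have -> : (z - v) ord0 ord0 = z ord0 ord0 - v ord0 ord0 by rewrite !mxE.
  by rewrite cons_row0 subr0.
have h1 : enorm z <= e / 4 + 2^-1.
  rewrite -[z](subrK v); apply: le_trans (enormD _ _) _.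
  by rewrite v1 lerD2r.
have h2 : 2^-1 <= e / 4 + enorm z.
  rewrite -v1 -[v](subrK z); apply: le_trans (enormD _ _) _.
  by rewrite lerD2r -enormN opprB.
(* As [e < 1], [enorm z] lies between [1 / 4] and [1], while the first coordinate is at most
   [e / 4]. *)
rewrite /slab /pball; apply/andP; split; first by apply/andP; split; lra.
by apply: le_trans z0 _; rewrite ler_pM2l//; lra.
Qed.

(** Each slice of the slab at fixed first coordinate is rotationally symmetric, so [lint_radial]
    factors [ball_int g] out, leaving a factor [C s] that does not depend on [g]. Comparison with
    [g = 1] identifies the remaining integral. *)
Lemma slab_average e (g : 'rV[R]_p.+1 -> R) : 0 < e < 1 -> angular g ->
  lint (fun z : 'rV[R]_p.+2 => ((slab e z)%:R * g (tail_row z))%:E) =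
  ((ball_avg g)%:E * slab_vol e)%E.
Proof.
move=> /andP[e0 e1] ag; have [_ g0 _] := ag.
have mz := @measurable_row_rv R p.+2.
pose phi (s r : R) : R := ((0 < Num.sqrt (s ^+ 2 + r ^+ 2) <= 1) &&
  (`|s| <= e * Num.sqrt (s ^+ 2 + r ^+ 2)))%:R.
have slabE s (y : 'rV[R]_p.+1) :
    (slab e (cons_row s y))%:R = (y != 0)%:R * phi s (enorm y) :> R.
  rewrite /slab /pball /phi cons_row0 enorm_cons.
  (* On the axis [y = 0] the slab is empty, because [e < 1]. *)
  have [->|y0] := eqVneq y 0; last by rewrite mul1r.
  rewrite mul0r; have /eqP -> : enorm (0 : 'rV[R]_p.+1) == 0
    by rewrite enorm_eq0.
  rewrite expr0n /= addr0 sqrtr_sqr;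
    case: (boolP (_ && _)) => // /andP[/andP[s0 _]].
  by rewrite ler_pMl ?leNgt ?e1.
have mphi s : measurable_fun setT (phi s).
  have ms : measurable_fun setT (fun r : R => Num.sqrt (s ^+ 2 + r ^+ 2)).
    apply: (measurableT_comp (f := @Num.sqrt R)).
      by apply: continuous_measurable_fun; exact: sqrt_continuous.
    by apply: measurable_funD => //; exact: measurable_funX.
  apply: measurable_indb; apply: measurable_and; first apply: measurable_and.
  - exact: measurable_fun_ltr.
  - exact: measurable_fun_ler.
  - by apply: measurable_fun_ler => //; exact: measurable_funM.
have phi0 s r : 0 <= phi s r by rewrite /phi.
pose C s : \bar R := (\int[@lebesgue_measure R]_r (@polar_density R p r * phi s
  r)%:E)%E.
have key (f : 'rV[R]_p.+1 -> R) : angular f -> forall s,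
    lint (fun y => ((slab e (cons_row s y))%:R * f y)%:E) = (ball_int f * C
      s)%E.
  move=> af s; rewrite -lint_radial//; congr lint; apply/funext => y.
  by rewrite slabE -mulrA (mulrC (phi _ _)).
have a1 : angular (fun _ : 'rV[R]_p.+1 => 1 : R) by exact: angular_cst.
have mtail (f : 'rV[R]_p.+1 -> R) : angular f ->
    borel_row (fun z : 'rV[R]_p.+2 => ((slab e z)%:R * f (tail_row z))%:E).
  move=> af; apply/measurable_EFinP; apply: measurable_funM.
    exact: measurable_slab.
  by apply: angular_measurable_row => //; exact: measurable_tail_row.
have split (f : 'rV[R]_p.+1 -> R) : angular f ->
    lint (fun z : 'rV[R]_p.+2 => ((slab e z)%:R * f (tail_row z))%:E) =
    (\int[@lebesgue_measure R]_s (ball_int f * C s))%E.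
  move=> af; have [_ f0 _] := af.
  rewrite lintS; [|exact: mtail|by move=> x; rewrite lee_fin mulr_ge0].
  apply: eq_integral => s _; rewrite -key//; congr lint; apply/funext => y.
  by rewrite tail_cons_row.
have -> : slab_vol e = (\int[@lebesgue_measure R]_s (ball_int (fun _ :
  'rV[R]_p.+1 => 1%R) * C s))%E.
  by rewrite -split//; congr lint; apply/funext => z; rewrite mulr1.
rewrite split//.
have b1 := @fine_ball_int1_gt0 R p.
have -> : ball_int g = ((ball_avg g)%:E * ball_int (fun _ : 'rV[R]_p.+1 =>
  1%R))%E.
  rewrite -[X in (_ * X)%E]fineK ?ball_int_fin// -EFinM mulfVK ?gt_eqF//.
  by rewrite fineK// ball_int_fin.
under eq_integral do rewrite -muleA.
have mC : measurable_fun setT (fun s => ball_int (fun _ : 'rV[R]_p.+1 => 1%R) *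
  C s)%E.
  under eq_fun do rewrite -key//.
  apply: measurable_lint; last by move=> s y; rewrite lee_fin mulr_ge0.
  apply/measurable_EFinP; apply: measurable_funM => //.
  apply: measurable_slab; apply: measurable_row_cons => //.
  exact: measurable_row_snd.
rewrite ge0_integralZl//.
- move=> s _; rewrite mule_ge0//; first exact: ball_int_ge0.
  by apply: integral_ge0 => r _; rewrite lee_fin mulr_ge0// polar_density_ge0.
- by rewrite lee_fin ball_avg_ge0.
Qed.

Definition cone_int (e : R) k (x : 'rV[R]_p.+2) : \bar R :=
  lint (fun y => ((pball y && (`|dot x y| <= e * (enorm x * enorm y)))%:R * k
    y)%:E).

(** The orthogonal matrix with first row [xi] turns the thickened [x^perp] into the standard
    slab. *)
Lemma cone_intE e k x : angular k -> x != 0 ->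
  let xi := (enorm x)^-1 *: x in
  cone_int e k x = lint (fun z => ((slab e z)%:R *
    k (z *m (col_mx xi (perp_frame xi) : 'M[R]_p.+2)))%:E).
Proof.
move=> ak x0 xi; have [_ k0 _] := ak.
have xi1 : sphere xi by exact: enorm_normalize.
have HE := perp_frameP xi1.
have ex : 0 < enorm x by rewrite enorm_gt0.
have xE : x = enorm x *: xi by rewrite scalerA mulfV ?scale1r// gt_eqF.
have OO := frame_col_isom xi1 HE.
rewrite /cone_int -(lint_isom OO).
- congr lint; apply/funext => z; congr ((nat_of_bool _)%:R * _)%:E.
  rewrite /slab /pball !enorm_isom//; congr (_ && _).
  rewrite {1}xE dotZl -{1}(cons_row_tail z) dot_frame//.
  by rewrite normrM gtr0_norm// mulrCA ler_pM2l.
- apply/measurable_EFinP; apply: measurable_funM;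
  last exact: angular_measurable.
  have mr := @measurable_row_rv R p.+2.
  apply: measurable_indb; apply: measurable_and; first exact: measurable_pball.
  apply: measurable_fun_ler.
    by apply: measurableT_comp => //; apply: measurable_dot => //;
      exact: measurable_row_cst.
  by apply: measurable_funM => //; apply: measurable_funM => //;
    exact: measurable_enorm_row.
- by move=> y; rewrite lee_fin mulr_ge0.
Qed.

(** On the slab, [k] is replaced by its value at the projection to the hyperplane, whose slab
    integral [slab_average] gives exactly. The two bounds are additive, which avoids subtraction of
    extended reals. *)
Lemma cone_int_approx e d eta k : angular k -> 0 < eta -> 0 < e < 1 -> e < d ->
  (forall u v, sphere u -> enorm (u - v) < d -> `|k u - k v| < eta) ->
  forall x, x != 0 ->
  (cone_int e k x <= (radon k x + eta)%:E * slab_vol e)%E /\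
  ((radon k x)%:E * slab_vol e <= cone_int e k x + eta%:E * slab_vol e)%E.
Proof.
move=> ak eta0 e01 ed hd x x0; have /andP[e0 e1] := e01.
have [hk k0 _] := ak.
rewrite cone_intE//; set xi := _ *: x; set O := col_mx _ _.
have xi1 : sphere xi by exact: enorm_normalize.
have HE := perp_frameP xi1; have [EE Exi] := HE.
have OO := frame_col_isom xi1 HE.
have aE := angular_isom EE ak; have [_ kE0 _] := aE.
have mz := @measurable_row_rv R p.+2.
(* The two points differ by the first coordinate times [xi]; after division by [enorm z] this has
   norm at most [e < d]. *)
have close z : slab e z -> `|k (z *m O) - k (tail_row z *m perp_frame xi)| <
  eta.
  move=> /andP[/andP[z0 _] ze].
  have iz : 0 < (enorm z)^-1 by rewrite invr_gt0.
  rewrite -(hk _ _ iz) -(hk _ (tail_row z *m _) iz); apply: hd.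
    by rewrite /sphere /= enormZ gtr0_norm// enorm_isom// mulVf// gt_eqF.
  rewrite -scalerBr -{2}(cons_row_tail z) cons_row_frame addrK enormZ [enorm (_
    *: xi)]enormZ xi1.
  rewrite mulr1 gtr0_norm// mulrC ltr_pdivrMr//.
  by apply: le_lt_trans ze _; rewrite ltr_pM2r.
have m1 : borel_row (fun z => ((slab e z)%:R * k (z *m O))%:E).
  apply/measurable_EFinP; apply: measurable_funM; first exact: measurable_slab.
  by apply: angular_measurable_row => //; exact: measurable_row_mulmx.
have m2 : borel_row (fun z => ((slab e z)%:R * k (tail_row z *m perp_frame
  xi))%:E).
  apply/measurable_EFinP; apply: measurable_funM; first exact: measurable_slab.
  apply: angular_measurable_row => //; apply: measurable_row_mulmx.
  exact: measurable_tail_row.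
have m3 : borel_row (fun z : 'rV[R]_p.+2 => (slab e z)%:R%:E).
  by apply/measurable_EFinP; exact: measurable_slab.
have p1 z : (0 <= ((slab e z)%:R * k (z *m O))%:E)%E
  by rewrite lee_fin mulr_ge0.
have p2 z : (0 <= ((slab e z)%:R * k (tail_row z *m perp_frame xi))%:E)%E.
  by rewrite lee_fin mulr_ge0.
have p3 (z : 'rV[R]_p.+2) : (0 <= (slab e z)%:R%:E :> \bar R)%E
  by exact: ind_ge0.
have et : (0 <= eta%:E)%E by rewrite lee_fin ltW.
have m4 : borel_row (fun z : 'rV[R]_p.+2 => eta%:E * (slab e z)%:R%:E)%E.
  exact: emeasurable_funM.
have p4 (z : 'rV[R]_p.+2) : (0 <= eta%:E * (slab e z)%:R%:E)%E
  by exact: mule_ge0.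
have r0 : 0 <= radon k x by exact: section_avg_ge0.
have av : lint (fun z => ((slab e z)%:R * k (tail_row z *m perp_frame xi))%:E) =
    ((radon k x)%:E * slab_vol e)%E.
  by rewrite (slab_average e01 aE).
split.
  rewrite EFinD ge0_muleDl// -av -lintZl// -lintD//.
  apply: le_lint => //; first exact: emeasurable_funD.
  move=> z; rewrite -EFinM -EFinD lee_fin.
  have := close z; case: (slab e z) => [/(_ isT)|_]; last
    by rewrite !(mul0r, mulr0) addr0.
  by rewrite !mul1r mulr1 -lerBlDl => /ltW; apply: le_trans; exact: ler_norm.
rewrite -av -lintZl// -lintD//.
apply: le_lint => //; first exact: emeasurable_funD.
move=> z; rewrite -EFinM -EFinD lee_fin.
have := close z; case: (slab e z) => [/(_ isT)|_]; last
  by rewrite !(mul0r, mulr0) addr0.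
rewrite !mul1r mulr1 -lerBlDl distrC => /ltW; apply: le_trans; exact: ler_norm.
Qed.

End SlabAverages.

(** * Self-adjointness of the Radon transform *)

Section RadonSelfAdjoint.
Context {R : realType} {p : nat}.
Implicit Types h k : 'rV[R]_p.+2 -> R.

Let cone_pair (e : R) h k : \bar R :=
  lint (fun x => ((pball x)%:R * h x)%:E * cone_int e k x)%E.

Let measurable_cone e (d : measure_display) (T : measurableType d)
    (f g : T -> 'rV[R]_p.+2) k : angular k -> measurable_row f ->
      measurable_row g ->
  measurable_fun setT (fun t => ((pball (g t) &&
    (`|dot (f t) (g t)| <= e * (enorm (f t) * enorm (g t))))%:R * k (g t))%:E).
Proof.
move=> ak mf mg; apply/measurable_EFinP; apply: measurable_funM; last first.
  exact: angular_measurable_row.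
apply: measurable_indb; apply: measurable_and; first exact: measurable_pball.
apply: measurable_fun_ler.
  by apply: measurableT_comp => //; exact: measurable_dot.
by apply: measurable_funM => //; apply: measurable_funM;
  exact: measurable_enorm_row.
Qed.

Let borel_cone_int e k : angular k -> borel_row (cone_int e k).
Proof.
move=> ak; have [_ k0 _] := ak; apply: measurable_lint.
  apply: measurable_cone => //; last exact: measurable_row_snd.
  exact: measurable_row_fst.
by move=> t x; rewrite lee_fin mulr_ge0.
Qed.

Let cone_int_ge0 e k x : angular k -> (0 <= cone_int e k x)%E.
Proof.
by move=> [_ k0 _]; apply: lint_ge0 => y; rewrite lee_fin mulr_ge0.
Qed.

Let cone_pairC e h k : angular h -> angular k ->
  cone_pair e h k = cone_pair e k h.
Proof.
move=> ah ak; have [_ h0 _] := ah; have [_ k0 _] := ak.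
pose F h k (x y : 'rV[R]_p.+2) : \bar R := (((pball x)%:R * h x)%:E *
  ((pball y && (`|dot x y| <= e * (enorm x * enorm y)))%:R * k y)%:E)%E.
have expand f g : angular f -> angular g ->
    cone_pair e f g = lint (fun x => lint (F f g x)).
  move=> [_ f0 _] ag; have [_ g0 _] := ag.
  congr lint; apply/funext => x; rewrite [RHS]lintZl//.
  - by apply: measurable_cone => //; exact: measurable_row_rv.
  - by move=> y; rewrite lee_fin mulr_ge0.
  - by rewrite lee_fin mulr_ge0.
rewrite (expand _ _ ah ak) (expand _ _ ak ah) lint_swap; last 2 first.
- apply: emeasurable_funM.
    apply/measurable_EFinP; apply: measurable_funM.
      by apply: measurable_indb; apply: measurable_pball;
        exact: measurable_row_fst.
    by apply: angular_measurable_row => //; exact: measurable_row_fst.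
  by apply: measurable_cone => //;
    [exact: measurable_row_fst|exact: measurable_row_snd].
- by move=> x y; rewrite mule_ge0// lee_fin mulr_ge0.
congr lint; apply/funext => x; congr lint; apply/funext => y.
rewrite /F -!EFinM dotC (mulrC (enorm y)) -!mulnb !natrM; congr _%:E; ring.
Qed.

Lemma radon_selfadj_le h k : angular h -> angular k ->
  fine (ball_int (fun x => h x * radon k x)) <=
  fine (ball_int (fun x => k x * radon h x)).
Proof.
move=> ah ak; have [_ h0 _] := ah; have [_ k0 _] := ak.
have aRh := angular_radon ah; have aRk := angular_radon ak.
have ahR := angularM ah aRk; have akR := angularM ak aRh.
have fh := ball_int_fin ah; have fk := ball_int_fin ak.
have fhR := ball_int_fin ahR; have fkR := ball_int_fin akR.
apply/ler_addgt0Pr => e0 e0_gt0.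
(* The two approximations cost [eta] times the integrals of [h] and of [k], relative to the slab
   volume; the [1] keeps [B] positive. *)
pose B := fine (ball_int h) + fine (ball_int k) + 1.
have B0 : 0 < B by rewrite ltr_wpDl// addr_ge0// fine_ge0// ball_int_ge0.
pose eta := e0 / B.
have eta0 : 0 < eta by rewrite divr_gt0.
have [d1 d10 hd1] := angular_unif ah eta0.
have [d2 d20 hd2] := angular_unif ak eta0.
(* [2^-1] keeps [e] below [1]; halving the minimum puts it strictly below both moduli of
   continuity. *)
pose e := Num.min 2^-1 (Num.min d1 d2 / 2).
have m0 : 0 < Num.min d1 d2 by rewrite lt_min d10.
have ed : e < Num.min d1 d2.
  rewrite gt_min; apply/orP; right.
  by rewrite ltr_pdivrMr// ltr_pMr// ltr1n.
have [ed1 ed2] : e < d1 /\ e < d2 by move: ed; rewrite lt_min => /andP.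
have e01 : 0 < e < 1.
  rewrite lt_min gt_min invr_gt0 ltr0n /= divr_gt0//=.
  by rewrite invf_lt1 ?ltr1n.
have st := slab_vol_gt0 (p := p) e01; have sf := @slab_vol_fin R p e.
pose t := fine (slab_vol (R := R) (p := p) e).
have t0 : 0 < t by apply: fine_gt0; rewrite st ltey_eq sf.
have tE : slab_vol (R := R) (p := p) e = t%:E by rewrite fineK.
have w0 (f : 'rV[R]_p.+2 -> R) x : angular f -> (0 <= ((pball x)%:R * f
  x)%:E)%E.
  by move=> [_ f0 _]; rewrite lee_fin mulr_ge0.
have mul_cst (f : 'rV[R]_p.+2 -> R) (c : R) : angular f -> 0 <= c ->
    (ball_int f * c%:E = lint (fun x => ((pball x)%:R * f x)%:E * c%:E))%E.
  move=> af c0; rewrite lintZr//; first exact: borel_ball_int.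
  by move=> x; exact: w0.
have mm (f : 'rV[R]_p.+2 -> R) (c : R) : angular f -> borel_row (fun x =>
  ((pball x)%:R * f x)%:E * c%:E)%E.
  by move=> af; apply: emeasurable_funM => //; exact: borel_ball_int.
have mp (f g : 'rV[R]_p.+2 -> R) : angular f -> angular g ->
    borel_row (fun x => ((pball x)%:R * f x)%:E * cone_int e g x)%E.
  move=> af ag; apply: emeasurable_funM; first exact: borel_ball_int.
  exact: borel_cone_int.
have p0 (f : 'rV[R]_p.+2 -> R) (c : R) x : angular f -> 0 <= c -> (0 <= ((pball
  x)%:R * f x)%:E * c%:E)%E.
  by move=> af c0; rewrite mule_ge0 ?w0// lee_fin.
have q0 (f g : 'rV[R]_p.+2 -> R) x : angular f -> angular g ->
    (0 <= ((pball x)%:R * f x)%:E * cone_int e g x)%E.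
  by move=> af ag; rewrite mule_ge0 ?w0 ?cone_int_ge0.
have et : 0 <= eta * t by rewrite mulr_ge0// ltW.
have t0' := ltW t0.
have lower : (ball_int (fun x => (h x * radon k x)%R) * t%:E <=
    cone_pair e h k + ball_int h * (eta * t)%:E)%E.
  rewrite !mul_cst// -lintD//; last 4 first.
  - exact: mp.
  - exact: mm.
  - by move=> x; exact: q0.
  - by move=> x; exact: p0.
  apply: le_lint; [exact: (mm _ t ahR)|
    by apply: emeasurable_funD; [exact: (mp _ _ ah ak)|exact: (mm _ _ ah)]| |].
    by move=> x; exact: (p0 _ _ _ ahR).
  move=> x; have [->|x0] := eqVneq x 0.
    have -> : pball (0 : 'rV[R]_p.+2) = false by rewrite /pball enorm_gt0 eqxx.
    by rewrite !mul0r !mul0e adde0.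
  have [_] := cone_int_approx ak eta0 e01 ed2 hd2 x0; rewrite tE => cle.
  rewrite mulrA [X in (X * _)%E]EFinM -muleA.
  apply: le_trans (lee_wpmul2l (w0 _ x ah) cle) _.
  by rewrite ge0_muleDr ?cone_int_ge0// -EFinM lee_fin.
have upper : (cone_pair e k h <= ball_int (fun x => (k x * radon h x)%R) * t%:E
  +
  ball_int k * (eta * t)%:E)%E.
  rewrite !mul_cst// -lintD//; last 4 first.
  - exact: (mm _ t akR).
  - exact: (mm _ _ ak).
  - by move=> x; exact: (p0 _ _ _ akR).
  - by move=> x; exact: (p0 _ _ _ ak).
  apply: le_lint; [exact: (mp _ _ ak ah)|
    by apply: emeasurable_funD; [exact: (mm _ _ akR)|exact: (mm _ _ ak)]| |].
    by move=> x; exact: (q0 _ _ _ ak ah).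
  move=> x; have [->|x0] := eqVneq x 0.
    have -> : pball (0 : 'rV[R]_p.+2) = false by rewrite /pball enorm_gt0 eqxx.
    by rewrite !mul0r !mul0e adde0.
  have [+ _] := cone_int_approx ah eta0 e01 ed1 hd1 x0; rewrite tE => cle.
  apply: le_trans (lee_wpmul2l (w0 _ x ak) cle) _.
  rewrite -!EFinM -EFinD lee_fin le_eqVlt; apply/orP; left; apply/eqP; ring.
(* The symmetric double integral links the two bounds; the common factor [t], the slab volume, is
   then cancelled. *)
move: lower; rewrite cone_pairC// => /le_trans.
move=> /(_ _ (leeD2r _ upper)).
rewrite -(fineK fh) -(fineK fk) -(fineK fhR) -(fineK fkR).
rewrite -!EFinM -!EFinD lee_fin => main.
have e0E : e0 = eta * B by rewrite divfK// gt_eqF.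
rewrite e0E -(ler_pM2r t0); apply: le_trans main _.
rewrite -subr_ge0 /B.
set a := fine (ball_int h); set b := fine (ball_int k); set c := fine _.
have -> : (c + eta * (a + b + 1)) * t - (c * t + b * (eta * t) + a * (eta * t))
  =
    eta * t by ring.
by rewrite mulr_ge0// ltW.
Qed.

Lemma radon_selfadj h k : angular h -> angular k ->
  ball_avg (fun x => h x * radon k x) = ball_avg (fun x => radon h x * k x).
Proof.
move=> ah ak; rewrite /ball_avg; congr (_ / _); apply/eqP; rewrite eq_le.
apply/andP; split.
  apply: le_trans (radon_selfadj_le ah ak) _.
  by rewrite le_eqVlt; apply/orP; left; apply/eqP; congr (fine (ball_int _));
    apply/funext => x; rewrite mulrC.
rewrite (_ : (fun x => radon h x * k x) = (fun x => k x * radon h x)).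
  exact: radon_selfadj_le.
by apply/funext => x; rewrite mulrC.
Qed.

Lemma radon_cst (c : R) : 0 <= c ->
  forall x, x != 0 -> radon (fun _ : 'rV[R]_p.+2 => c) x = c.
Proof. by move=> c0 x x0; exact: ball_avg_cst. Qed.

(** [radon] is self-adjoint and fixes the constant [1]. *)
Lemma ball_avg_radon h : angular h -> ball_avg (radon h) = ball_avg h.
Proof.
move=> ah; have a1 : angular (fun _ : 'rV[R]_p.+2 => 1 : R)
  by exact: angular_cst.
transitivity (ball_avg (fun x => 1 * radon h x)).
  by apply: eq_ball_avg => x _; rewrite mul1r.
rewrite radon_selfadj//; apply: eq_ball_avg => x x0.
by rewrite radon_cst// mul1r.
Qed.

End RadonSelfAdjoint.

(** * Average sections of gauge balls *)

Section SurfaceIntegral.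
Context {R : realType}.

Lemma measurable_sphere n : measurable (@rv R n @^-1` @sphere R n).
Proof.
have h : measurable_fun setT (fun t : Rtuple R n => enorm (rv t)).
  exact: measurable_enorm_row (@measurable_row_rv R _).
have := h measurableT [set 1] (measurable_set1 1).
by rewrite setTI.
Qed.

(* Sending everything outside the punctured ball to [0], which is not on the
   sphere, turns the surface measure into an image of Lebesgue measure. *)
Lemma integral_surface n (h : 'rV[R]_n -> R) : angular h ->
  (\int[@surface_measure R n]_(t in @rv R n @^-1` @sphere R n) (h (rv t))%:E =
   n%:R%:E * ball_int h)%E.
Proof.
move=> ah; have [hh h0 _] := ah.
pose psi (t : Rtuple R n) : Rtuple R n :=
  tv (((pball (rv t))%:R * (enorm (rv t))^-1) *: rv t).
have mr := @measurable_row_rv R n.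
have mpsi : measurable_fun setT psi.
  apply/measurable_fun_tnthP => i.
  have : measurable_row (fun t : Rtuple R n =>
      ((pball (rv t))%:R * (enorm (rv t))^-1) *: rv t).
    apply: measurable_rowZ => //; apply: measurable_funM.
      by apply: measurable_indb; exact: measurable_pball.
    apply: (measurableT_comp measurable_inv_realType).
    exact: measurable_enorm_row.
  by move/(_ i); apply: eq_measurable_fun => t _ /=; rewrite tnth_mktuple.
have psi1 t : pball (rv t) -> rv (psi t) = (enorm (rv t))^-1 *: rv t.
  by move=> bt; rewrite tvK bt mul1r.
have psiB t : sphere (rv (psi t)) <-> pball (rv t).
  split=> [|bt].
    rewrite tvK /sphere /= enormZ; case: (pball (rv t)) => //.
    by rewrite mul0r normr0 mul0r => /esym/eqP; rewrite oner_eq0.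
  rewrite psi1//; apply: enorm_normalize; rewrite -enorm_gt0.
  by case/andP: bt.
pose k : {nonneg R} := NngNum (ler0n R n).
pose mu0 : {measure set (Rtuple R n) -> \bar R} :=
  mscale k (pushforward (@lebesgue_tuple R n) psi).
pose mu := mu0 mpsi.
have mh : measurable_fun (@rv R n @^-1` @sphere R n)
    (fun t : Rtuple R n => (h (rv t))%:E).
  by apply: measurable_funTS; apply/measurable_EFinP; exact: angular_measurable.
have ms := @measurable_sphere n.
transitivity (\int[mu]_(t in @rv R n @^-1` @sphere R n) (h (rv t))%:E)%E.
  apply: eq_measure_integral => A mA AS.
  rewrite /mu /mu0 /= /mscale /pushforward /surface_measure;
    congr (_ * lebesgue_tuple _)%E.
  apply/seteqP; split => t /=.
    move=> [bt At]; suff -> : psi t = normalize t by [].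
    by rewrite /psi /normalize /pball bt mul1r.
  move=> At; have bt : pball (rv t) by apply/psiB; exact: AS.
  split => //; suff -> : normalize t = psi t by [].
  by rewrite /psi bt mul1r.
rewrite ge0_integral_mscale//; last by move=> t _; rewrite lee_fin.
congr (_ * _)%E.
rewrite (@ge0_integral_pushforward _ _ _ _ _ _ mpsi)//; last by move=> t _;
  rewrite lee_fin.
rewrite /ball_int /lint ge0_integral_ind.
rewrite (_ : psi @^-1` _ = [set t | pball (rv t)]).
  apply: eq_integral => t /set_mem bt /=.
  rewrite psi1// angular_normalize// -enorm_gt0.
  by case/andP: bt.
by apply/seteqP; split => t /= /psiB.
Qed.

Lemma sphere_areaE n : sphere_area R n = n%:R * fine (ball_int (fun _ :
  'rV[R]_n => 1)).
Proof.
have a1 : angular (fun _ : 'rV[R]_n => 1 : R) by exact: angular_cst.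
rewrite /sphere_area -[X in fine X]mul1e.
have ms := @measurable_sphere n.
rewrite -[X in fine X](@integral_cst _ _ _ (@surface_measure R n) _ ms 1).
rewrite (@integral_surface n (fun=> 1) a1) fineM// ball_int_fin//.
Qed.

End SurfaceIntegral.

Section AverageSection.
Context {R : realType} {p : nat}.
Implicit Types N : 'rV[R]_p.+2 -> R.

Lemma hsection_gauge N xi :
  hsection [set x | N x <= 1] xi = [set y | N (y *m perp_frame xi) <= 1].
Proof. by []. Qed.

Lemma vol_hsection_gauge N xi : gauge N -> sphere xi ->
  vol (hsection [set x | N x <= 1] xi) =
  vol (@ball2 R p.+1) * section_avg (fun x => gauge_ratio N x ^+ p.+1) xi.
Proof.
move=> gN xi1; have [EE _] := perp_frameP xi1.
rewrite hsection_gauge vol_gauge; last exact: gauge_isom.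
rewrite fine_ball_int; congr (_ * ball_avg _); apply/funext => y.
by rewrite /gauge_ratio enorm_isom.
Qed.

Lemma avg_section_gauge N : gauge N ->
  avg_section [set x | N x <= 1] =
  vol (@ball2 R p.+1) * ball_avg (fun x => gauge_ratio N x ^+ p.+1).
Proof.
move=> gN; have ag := angularX p.+1 (angular_gauge_ratio gN).
have aR := angular_radon ag.
have V0 := vol_ball2_gt0 (R := R) p.
have aVR : angular (fun x => vol (@ball2 R p.+1) * radon (fun x => gauge_ratio
  N x ^+ p.+1) x).
  by apply: angularM => //; apply: angular_cst; exact: ltW.
rewrite /avg_section /Rintegral.
rewrite (eq_integral (fun t => (vol (@ball2 R p.+1) *
   radon (fun x => gauge_ratio N x ^+ p.+1) (rv t))%:E)); last first.
  move=> t /set_mem st;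
    by rewrite (vol_hsection_gauge gN st) (radon_sphere _ st).
rewrite (integral_surface aVR) sphere_areaE.
rewrite fineM; [|by []|exact: ball_int_fin].
rewrite -(ball_avg_radon ag) -(ball_avgZ aR (ltW V0)) /ball_avg.
have b1 := @fine_ball_int1_gt0 R p.+1.
set u := fine (ball_int (fun=> 1)); set w := fine _.
(* The dimension factor of the surface measure cancels against the one in the sphere area. *)
have wE : p.+2%:R^-1 * w = 1 by rewrite /w /= mulVf// pnatr_eq0.
by rewrite invfM mulrACA wE mul1r mulrC.
Qed.

End AverageSection.

(** * Star bodies and intersection bodies *)

Section StarBodies.
Context {R : realType} {n : nat}.
Implicit Types (K : set 'rV[R]_n) (x u : 'rV[R]_n).

Lemma near_line (A : set 'rV[R]_n) u (s : R) : nbhs (s *: u) A ->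
  exists2 d : R, 0 < d & forall t, `|s - t| < d -> A (t *: u).
Proof.
move=> sA; have cl : {for s, continuous (fun t : R => t *: u)}.
  by apply: continuousZ; [exact: cvg_id|exact: cst_continuous].
have /nbhs_ballP[d /= d0 hd] := cl _ sA.
by exists d => // t st; apply: hd; rewrite -ball_normE.
Qed.

(** Take the supremum of the parameters in [[p, q]] whose points lie in [K]: closedness puts that
    point in [K], and points just beyond it are outside. The strict bound [t < q] keeps boundary
    points from successive intervals apart. *)
Lemma boundary_between K u (p q : R) : closed K -> p < q ->
  K (p *: u) -> ~ K (q *: u) -> exists2 t, p <= t < q & boundary K (t *: u).
Proof.
move=> cK pq Kp Kq.
pose E := [set t : R | p <= t <= q /\ K (t *: u)].
have Ep : E p by split => //; rewrite lexx ltW.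
have hE : has_sup E.
  by split; [exists p|exists q => t [/andP[]]].
pose s := sup E.
have ps : p <= s by apply: ub_le_sup => //; case: hE.
have sq : s <= q by apply: ge_sup; [exists p|move=> t [/andP[]]].
have Ks : K (s *: u).
  apply: contrapT => nKs.
  have [d d0 hd] : exists2 d : R, 0 < d & forall t, `|s - t| < d -> (~` K) (t
    *: u).
    by apply: near_line; apply: open_nbhs_nbhs; split => //;
      exact: closed_openC.
  have [t [tpq Kt] st] := sup_adherent d0 hE.
  apply: (hd t) => //; have ts : t <= s by apply: ub_le_sup => //; case: hE.
  by rewrite ger0_norm ?subr_ge0// ltrBlDl -ltrBlDr.
have {}sq : s < q.
  by rewrite lt_neqAle sq andbT; apply/eqP => sqE; apply: Kq; rewrite -sqE.
exists s; first by rewrite ps.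
split; first exact: subset_closure.
move=> iK; have [d d0 hd] := near_line iK.
pose t := Num.min q (s + d / 2).
have st : s < t by rewrite lt_min sq ltrDl divr_gt0.
have : E t.
  split; first by rewrite (le_trans ps (ltW st)) /= ge_min lexx.
  apply: hd; rewrite distrC ger0_norm ?subr_ge0 ?(ltW st)//.
  rewrite ltrBlDl gt_min; apply/orP; right.
  by rewrite ltrD2l ltr_pdivrMr// ltr_pMr// ltr1n.
move=> Et; have : t <= s by apply: ub_le_sup => //; case: hE.
by rewrite leNgt st.
Qed.

Lemma boundary_neq0 K u t : K° 0 -> boundary K (t *: u) -> t != 0.
Proof.
by move=> K0 [_ nK]; apply/eqP => t0; apply: nK; rewrite t0 scale0r.
Qed.

(** If [c *: y] were outside [K], the line through [y] would meet the boundary three times away from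
    [0]: before [c], after [1], and on the opposite ray. *)
Lemma star_body_starshaped K y c : star_body K -> K y -> 0 < c <= 1 ->
  K (c *: y).
Proof.
move=> [cK bK lK K0 _] Ky /andP[c0 c1]; apply: contrapT => nKc.
have KK0 : K 0 by exact: nbhs_singleton.
have y0 : y != 0 by apply/eqP => y0; apply: nKc; rewrite y0 scaler0.
have {}c1 : c < 1.
  rewrite lt_neqAle c1 andbT; apply/eqP => c1E; apply: nKc.
  by rewrite c1E scale1r.
have [M [Mr hM]] := bK.
have y1 : 0 < `|y| by rewrite normr_gt0.
(* A vector of norm [|y|] scaled by [T] exceeds the bound on [K]; this is applied to [y] and to
   [- y]. *)
pose T := (`|M| + 2) / `|y| + 1.
have T1 : 1 < T by rewrite ltrDr divr_gt0// ltr_wpDl.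
have nT v : `|v| = `|y| -> ~ K (T *: v).
  move=> vy Kv; have := hM (`|M| + 1).
  rewrite (le_lt_trans (ler_norm _)) ?ltrDl// => /(_ erefl _ Kv).
  rewrite /= normrZ vy gtr0_norm ?(lt_trans ltr01)// /T mulrDl mul1r divfK
    ?gt_eqF//.
  by move=> h; have := lt_le_trans _ h; lra.
have Kz v : K (0 *: v) by rewrite scale0r.
have Ky1 : K (1 *: y) by rewrite scale1r.
have [t1 /andP[t10 t1c] B1] := boundary_between cK c0 (Kz y) nKc.
have [t2 /andP[t21 _] B2] := boundary_between cK T1 Ky1 (nT _ erefl).
have [t3 /andP[t30 _] B3] := boundary_between cK (lt_trans ltr01 T1) (Kz (- y))
  (nT _ (normrN _)).
have t1n := boundary_neq0 K0 B1; have t3n := boundary_neq0 K0 B3.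
have [a [b [_ _ _ abE]]] := lK y y0.
have h t : t != 0 -> boundary K (t *: y) -> t = a \/ t = b.
  by move=> t0 Bt; have : [set a; b] t by rewrite -abE.
have t1p : 0 < t1 by rewrite lt_neqAle eq_sym t1n.
have t3p : 0 < t3 by rewrite lt_neqAle eq_sym t3n.
have t2p : 0 < t2 by exact: lt_le_trans t21.
have t12 : t1 < t2 by rewrite (lt_trans t1c)// (lt_le_trans c1).
have B3' : boundary K (- t3 *: y) by rewrite scaleNr -scalerN.
have e1 := h _ t1n B1; have e2 := h _ (lt0r_neq0 t2p) B2.
have t3n' : - t3 != 0 by rewrite oppr_eq0.
have e3 := h _ t3n' B3'.
(* The numbers [- t3 < 0 < t1 < t2] cannot all belong to a two-element set. *)
by move: e1 e2 e3 => [] ? [] ? [] ?; lra.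
Qed.

Let mink_set K x := [set a : R | 0 <= a /\ exists2 y, K y & x = a *: y].

Let mink_lb K x : lbound (mink_set K x) 0.
Proof. by move=> a []. Qed.

Let mink_nonempty K x : K° 0 -> mink_set K x !=set0.
Proof.
move=> K0; have KK0 : K 0 by exact: nbhs_singleton.
have [->|x0] := eqVneq x 0.
  by exists 0; split => //; exists 0 => //; rewrite scaler0.
have : nbhs (0 *: x) K by rewrite scale0r.
move=> /near_line[d d0 hd]; exists (2 / d); split; first
  by rewrite divr_ge0// ltW.
exists ((d / 2) *: x).
  apply: hd; rewrite sub0r normrN gtr0_norm ?divr_gt0//.
  by rewrite ltr_pdivrMr// ltr_pMr// ltr1n.
rewrite scalerA (_ : 2 / d * (d / 2) = 1) ?scale1r//.
by field; rewrite gt_eqF.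
Qed.

Let mink_le K x a : mink_set K x a -> Defs.minkowski K x <= a.
Proof. by move=> ha; apply: ge_inf => //; exists 0; exact: mink_lb. Qed.

Let mink_scale_le K c x : K° 0 -> 0 < c ->
  Defs.minkowski K (c *: x) <= c * Defs.minkowski K x.
Proof.
move=> K0 c0; rewrite -ler_pdivrMl//; apply: lb_le_inf;
  first exact: mink_nonempty.
move=> a [a0 [y Ky xE]]; rewrite ler_pdivrMl//; apply: mink_le.
split; first by rewrite mulr_ge0// ltW.
by exists y => //; rewrite xE scalerA.
Qed.

Lemma minkowski_gauge K : star_body K -> gauge (Defs.minkowski K).
Proof.
move=> [cK bK lK K0 contK]; split => [c x c0|x x0|x _]; last exact: contK.
  apply/eqP; rewrite eq_le mink_scale_le//=.
  rewrite -ler_pdivlMl//.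
  have := @mink_scale_le K c^-1 (c *: x) K0;
    rewrite invr_gt0 scalerA mulVf ?gt_eqF// scale1r.
  exact.
have [M [Mr hM]] := bK; pose M1 := `|M| + 1.
have M10 : 0 < M1 by rewrite ltr_wpDl.
have nx : 0 < `|x| by rewrite normr_gt0.
apply: (@lt_le_trans _ _ (`|x| / M1)); first by rewrite divr_gt0.
apply: lb_le_inf; first exact: mink_nonempty.
move=> a [a0 [y Ky ->]]; rewrite normrZ ger0_norm// ler_pdivrMr//.
rewrite ler_wpM2l//; apply: hM Ky.
by rewrite (le_lt_trans (ler_norm _))// ltrDl.
Qed.

Lemma star_body_minkowskiE K : star_body K -> K = [set x | Defs.minkowski K x
  <= 1].
Proof.
move=> sK; have [cK bK lK K0 contK] := sK.
have KK0 : K 0 by exact: nbhs_singleton.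
have [hN pN _] := minkowski_gauge sK.
have lt1 x : Defs.minkowski K x < 1 -> K x.
  move=> Nx.
  have hi : has_inf (mink_set K x).
    by split; [exact: mink_nonempty|exists 0; exact: mink_lb].
  have [|a [a0 [y Ky ->]] a1] := @inf_adherent _ _ (1 - Defs.minkowski K x) _
    hi.
    by rewrite subr_gt0.
  have {}a1 : a < 1 by rewrite (lt_le_trans a1)// addrC subrK.
  have [a00|an0] := eqVneq a 0; first by rewrite a00 scale0r.
  by apply: star_body_starshaped => //; rewrite lt_neqAle eq_sym an0 a0 ltW.
apply/seteqP; split => x /=.
  by move=> Kx; apply: mink_le; split => //; exists x => //; rewrite scale1r.
rewrite le_eqVlt => /orP[/eqP Nx|]; last exact: lt1.
apply: contrapT => nKx.
have : nbhs (1 *: x) (~` K).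
  by rewrite scale1r; apply: open_nbhs_nbhs; split => //; exact: closed_openC.
move=> /near_line[d d0 hd].
(* A positive factor below [1] and within [d] of it: [c *: x] would lie outside [K] although its
   functional is [c < 1]. *)
pose c := Num.max 2^-1 (1 - d / 2).
have c1 : c < 1.
  by rewrite gt_max invf_lt1 ?ltr1n//= gtrBl divr_gt0.
have c0 : 0 < c by rewrite lt_max invr_gt0 ltr0n.
apply: (hd c); last by apply: lt1; rewrite hN// Nx mulr1.
rewrite ger0_norm ?subr_ge0 ?ltW// ltrBlDl -ltrBlDr lt_max; apply/orP; right.
by rewrite ltrD2l ltrN2 ltr_pdivrMr// ltr_pMr// ltr1n.
Qed.

End StarBodies.

(** The graph of the convex function [r ^+ n.+1] lies above its tangent at [a]. In the induction the
    difference is [r] times the previous one plus a multiple of [(r - a) ^+ 2]. *)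
Lemma tangent_power_le (R : realType) (n : nat) (a r : R) : 0 <= a -> 0 <= r ->
  n.+1%:R * a ^+ n * r <= r ^+ n.+1 + n%:R * a ^+ n.+1.
Proof.
move=> a0 r0; elim: n => [|n IH]; first
  by rewrite !expr1 expr0 mulr1 mul1r mul0r addr0.
have h := mulr_ge0 r0 (etrans (subr_ge0 _ _) IH).
have h2 : 0 <= n.+1%:R * a ^+ n * (r - a) ^+ 2
  by rewrite mulr_ge0 ?sqr_ge0// mulr_ge0// exprn_ge0.
rewrite -subr_ge0.
have -> : r ^+ n.+2 + n.+1%:R * a ^+ n.+2 - n.+2%:R * a ^+ n.+1 * r =
  r * (r ^+ n.+1 + n%:R * a ^+ n.+1 - n.+1%:R * a ^+ n * r) +
  n.+1%:R * a ^+ n * (r - a) ^+ 2.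
  rewrite !exprS -(natr1 n.+1) -(natr1 n); ring.
exact: addr_ge0.
Qed.

(** Jensen's inequality, by averaging the tangent bound at [a], a point slightly above the power
    mean. The excess [e] makes [a] positive even if the mean vanishes, so that [a ^+ n] can be
    cancelled. *)
Lemma ball_avg_power_mean (R : realType) (n p : nat) (r : 'rV[R]_p.+1 -> R) :
  angular r -> ball_avg r <= ball_avg (fun x => r x ^+ n.+1) `^ (n.+1%:R^-1).
Proof.
move=> ar; have [_ r0 _] := ar; have arn := angularX n.+1 ar.
set A := ball_avg (fun x => r x ^+ n.+1).
have A0 : 0 <= A by exact: ball_avg_ge0.
have n0 : n.+1%:R != 0 :> R by rewrite pnatr_eq0.
apply/ler_addgt0Pr => e e0; set a := _ + e.
have b0 : 0 <= A `^ n.+1%:R^-1 by exact: powR_ge0.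
have a0 : 0 < a by rewrite ltr_wpDl.
have Aa : A <= a ^+ n.+1.
  rewrite -[leLHS](powRr1 A0) -(mulVf n0) powRrM powR_mulrn ?powR_ge0//.
  by rewrite ler_pXn2r ?nnegrE ?(ltW a0)// lerDl ltW.
have an : 0 <= n.+1%:R * a ^+ n by rewrite mulr_ge0// exprn_ge0// ltW.
have c0 : 0 <= n%:R * a ^+ n.+1 by rewrite mulr_ge0// exprn_ge0// ltW.
have h : n.+1%:R * a ^+ n * ball_avg r <= A + n%:R * a ^+ n.+1.
  rewrite -ball_avgZ// -[X in _ + X](@ball_avg_cst R p _ c0) -ball_avgD//;
    last exact: angular_cst.
  apply: ball_avg_le.
  - by apply: angularM => //; exact: angular_cst.
  - by apply: angularD => //; exact: angular_cst.
  - by move=> x _; apply: tangent_power_le => //; exact: ltW.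
have an0 : 0 < n.+1%:R * a ^+ n by rewrite mulr_gt0// exprn_gt0.
rewrite -(ler_pM2l an0); apply: le_trans h _.
have -> : n.+1%:R * a ^+ n * a = a ^+ n.+1 + n%:R * a ^+ n.+1.
  by rewrite exprS -natr1; ring.
by rewrite lerD2r.
Qed.

(** * The moment inequality for intersection bodies *)

Section IntersectionBodies.
Context {R : realType} {q : nat}.
Implicit Types K L : set 'rV[R]_q.+3.

Let ratio K := gauge_ratio (@Defs.minkowski R q.+3 K).

Let angular_ratio K : star_body K -> angular (ratio K).
Proof. by move=> /minkowski_gauge; exact: angular_gauge_ratio. Qed.

Lemma radial_ratio K xi : sphere xi -> radial K xi = ratio K xi.
Proof. by move=> xi1; rewrite /radial /ratio /gauge_ratio xi1 mul1r. Qed.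

(** This is [rho = T f] with [f] equal to the volume of the unit ball times [ratio L ^+ q.+2], since
    section volumes of [L] are themselves Radon transforms. *)
Lemma ratio_intersection_body_of K L : intersection_body_of K L ->
  forall x, x != 0 ->
  ratio K x = vol (@ball2 R q.+2) * radon (fun y => ratio L y ^+ q.+2) x.
Proof.
move=> [[sK _] [sL _] KL] x x0.
have x1 := enorm_normalize x0; have aK := angular_ratio sK.
rewrite -(angular_normalize aK x0) -radial_ratio// KL//.
rewrite {1}(star_body_minkowskiE sL) vol_hsection_gauge//.
exact: minkowski_gauge.
Qed.

(** Both ratios are bounded, so the [sup] in [radial_dist] is a genuine upper bound. *)
Lemma radial_dist_ratio K L (e : R) : star_body K -> star_body L ->
  radial_dist K L < e -> forall x, x != 0 -> `|ratio K x - ratio L x| <= e.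
Proof.
move=> sK sL dKL x x0; have aK := angular_ratio sK; have aL := angular_ratio sL.
have x1 := enorm_normalize x0.
rewrite -(angular_normalize aK x0) -(angular_normalize aL x0).
rewrite -!radial_ratio//; apply: le_trans (ltW dKL).
apply: ub_le_sup; last by exists ((enorm x)^-1 *: x).
have [M M0 hM] := angular_bounded aK; have [M' M0' hM'] := angular_bounded aL.
have [_ rK _] := aK; have [_ rL _] := aL.
exists (M + M') => _ [xi xi1 <-]; rewrite !radial_ratio//.
rewrite (le_trans (ler_normB _ _))// lerD//.
  by rewrite ger0_norm.
by rewrite ger0_norm.
Qed.

(* [K] is approximated by [K'] with [ratio K' = V * radon f], [f >= 0]. Then
   [avg (g * radon f) = avg (radon g * f) <= B * avg f = B * avg (radon f)]
   for [g = ratio K ^+ q.+1], whose sections have averages at most [B]. *)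
Lemma intersection_body_moment_le K (B : R) : intersection_body K ->
  (forall xi, sphere xi ->
    section_avg (fun x => ratio K x ^+ q.+1) xi <= B) ->
  ball_avg (fun x => ratio K x ^+ q.+2) <= B * ball_avg (ratio K).
Proof.
move=> [[sK _] hK] hB; have aK := angular_ratio sK.
set g := fun x => _ ^+ q.+1 in hB.
have ag : angular g by exact: angularX.
have gB := radon_le ag hB.
have B0 : 0 <= B.
  have e0 : (delta_mx ord0 ord0 : 'rV[R]_q.+3) != 0.
    apply/eqP => /matrixP/(_ ord0 ord0)/eqP; rewrite !mxE !eqxx.
    by rewrite oner_eq0.
  by apply: le_trans (gB _ e0); have [_ + _] := angular_radon ag; exact.
have Ag := ball_avg_ge0 ag.
apply/ler_addgt0Pr => e0 e0_gt0.
(* Passing from [K] to [K'] costs [e * ball_avg g] in [step1], and returning costs [e * B] in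
   [step3]; the [1] makes [C] positive. *)
pose C := ball_avg g + B + 1.
have C0 : 0 < C by rewrite ltr_wpDl// addr_ge0.
pose e := e0 / C.
have e_gt0 : 0 < e by rewrite divr_gt0.
have ae : angular (fun _ : 'rV[R]_q.+3 => e) by apply: angular_cst; exact: ltW.
have [K' [L [KL dK]]] := hK _ e_gt0.
have [[sK' _] [sL _] _] := KL.
have aK' := angular_ratio sK'; have aL := angular_ratio sL.
have near := radial_dist_ratio sK sK' dK.
pose V := vol (@ball2 R q.+2).
have V0 : 0 < V by exact: vol_ball2_gt0.
pose f x := ratio L x ^+ q.+2.
have af : angular f by exact: angularX.
have aRf := angular_radon af; have aRg := angular_radon ag.
have K'E : forall x, x != 0 -> ratio K' x = V * radon f x.
  exact: ratio_intersection_body_of.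
have step1 : ball_avg (fun x => ratio K x ^+ q.+2) <=
    ball_avg (fun x => g x * ratio K' x) + e * ball_avg g.
  rewrite -(ball_avgZ ag (ltW e_gt0)) -(ball_avgD (angularM ag aK') (angularM
    ae ag)).
  apply: ball_avg_le; first exact: angularX.
    by apply: angularD; exact: angularM.
  move=> x x0; rewrite exprSr -/(g x) (mulrC e) -mulrDr.
  have [_ g0 _] := ag; apply: ler_wpM2l => //.
  have := near x x0; rewrite ler_norml => /andP[_].
  by rewrite lerBlDl.
have step2 : ball_avg (fun x => g x * ratio K' x) <= B * ball_avg (ratio K').
  have -> : ball_avg (fun x => g x * ratio K' x) =
      V * ball_avg (fun x => radon g x * f x).
    rewrite -(radon_selfadj ag af) -(ball_avgZ (angularM ag aRf) (ltW V0)).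
    by apply: eq_ball_avg => x x0; rewrite K'E// mulrCA.
  have -> : ball_avg (ratio K') = V * ball_avg f.
    rewrite -(ball_avg_radon af) -(ball_avgZ aRf (ltW V0)).
    exact: eq_ball_avg.
  rewrite [leRHS]mulrCA.
rewrite (ler_pM2l V0) -(ball_avgZ af B0).
  apply: ball_avg_le; first exact: angularM.
    by apply: angularM => //; exact: angular_cst.
  by move=> x x0; have [_ f0 _] := af; apply: ler_wpM2r => //; exact: gB.
have step3 : ball_avg (ratio K') <= ball_avg (ratio K) + e.
  rewrite -[X in _ + X](@ball_avg_cst R q.+2 e (ltW e_gt0)) -(ball_avgD aK ae).
  apply: ball_avg_le => //; first exact: angularD.
  move=> x x0; have := near x x0; rewrite ler_norml => /andP[+ _].
  by rewrite lerBrDr addrC lerBlDr.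
apply: le_trans step1 _; rewrite -lerBrDr; apply: le_trans step2 _.
apply: le_trans (ler_wpM2l B0 step3) _.
have -> : e0 = e * C by rewrite divfK// gt_eqF.
rewrite -subr_ge0 /C.
have -> : B * ball_avg (ratio K) + e * (ball_avg g + B + 1) - e * ball_avg g -
  B * (ball_avg (ratio K) + e) = e by ring.
exact: ltW.
Qed.

Lemma avg_section_star_body K : star_body K ->
  avg_section K = vol (@ball2 R q.+2) * ball_avg (fun x => ratio K x ^+ q.+2).
Proof.
move=> sK; rewrite {1}(star_body_minkowskiE sK) avg_section_gauge//.
exact: minkowski_gauge.
Qed.

Lemma vol_star_body K : star_body K ->
  vol K = vol (@ball2 R q.+3) * ball_avg (fun x => ratio K x ^+ q.+3).
Proof.
move=> sK; rewrite {1}(star_body_minkowskiE sK) vol_gauge ?fine_ball_int//.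
exact: minkowski_gauge.
Qed.

End IntersectionBodies.

Lemma avg_section_hsection_gauge (R : realType) q (N : 'rV[R]_q.+3 -> R) xi :
  gauge N -> sphere xi ->
  avg_section (hsection [set x | N x <= 1] xi) =
  vol (@ball2 R q.+1) * section_avg (fun x => gauge_ratio N x ^+ q.+1) xi.
Proof.
move=> gN xi1; have [EE _] := perp_frameP xi1.
rewrite hsection_gauge avg_section_gauge; last exact: gauge_isom.
congr (_ * ball_avg _); apply/funext => y.
by rewrite /gauge_ratio enorm_isom.
Qed.

(** Continuity of [radon h] on the compact sphere; this is what makes the maximum in the theorem
    attained. *)
Lemma section_avg_max (R : realType) p (h : 'rV[R]_p.+2 -> R) : angular h ->
  exists2 xi, sphere xi & forall eta, sphere eta ->
    section_avg h eta <= section_avg h xi.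
Proof.
move=> ah; have [_ _ cR] := angular_radon ah.
have S0 : @sphere R p.+2 !=set0.
  exists ((enorm (delta_mx ord0 ord0 : 'rV[R]_p.+2))^-1 *: delta_mx ord0 ord0).
  apply: enorm_normalize.
  apply/eqP => /matrixP/(_ ord0 ord0)/eqP; rewrite !mxE !eqxx.
  by rewrite oner_eq0.
have [] := @compact_EVT_max _ _ (radon h) _ S0 (@compact_sphere R p.+2).
  by apply: continuous_in_subspaceT => x /set_mem /sphere_neq0; exact: cR.
move=> xi /set_mem xi1 hxi; exists xi; [exact: xi1|move=> eta eta1].
rewrite -(radon_sphere _ eta1) -(radon_sphere _ xi1); apply: hxi.
exact/mem_set.
Qed.

Theorem corollary2 (R : realType) (n : nat) (hn : (3 <= n)%N) :
  let c : R := vol (@ball2 R n.-1) /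
    (vol (@ball2 R n.-2) * vol (@ball2 R n) `^ (n%:R^-1)) in
  (forall K : set 'rV[R]_n, intersection_body K ->
    exists2 M : R,
      is_sphere_max (fun xi : 'rV[R]_n => avg_section (hsection K xi)) M &
      avg_section K <= c * M * vol K `^ (n%:R^-1)) /\
  (exists2 M : R,
      is_sphere_max
        (fun xi : 'rV[R]_n => avg_section (hsection (@ball2 R n) xi)) M &
      avg_section (@ball2 R n) = c * M * vol (@ball2 R n) `^ (n%:R^-1)).
Proof.
case: n hn => [//|[//|[//|q]]] _ c.
have V1 := vol_ball2_gt0 (R := R) q; have V2 := vol_ball2_gt0 (R := R) q.+1.
have V3 := vol_ball2_gt0 (R := R) q.+2.
have P3 : 0 < vol (@ball2 R q.+3) `^ (q.+3%:R^-1) by exact: powR_gt0.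
split.
  move=> K iK; have [[sK _] _] := iK; have gK := minkowski_gauge sK.
  have aK := angular_gauge_ratio gK; have ag := angularX q.+1 aK.
  have secE xi : sphere xi -> avg_section (hsection K xi) =
      vol (@ball2 R q.+1) *
      section_avg (fun x => gauge_ratio (Defs.minkowski K) x ^+ q.+1) xi.
    by move=> xi1; rewrite {1}(star_body_minkowskiE sK) (avg_section_hsection_gauge gK xi1).
  have [xi0 xi01 hmax] := section_avg_max ag.
  set B := section_avg _ xi0 in hmax.
  exists (vol (@ball2 R q.+1) * B).
    split; first by exists xi0; [exact: xi01|exact: secE].
    by move=> xi xi1; rewrite (secE _ xi1) (ler_pM2l V1); exact: hmax.
  have moment := intersection_body_moment_le iK hmax.
  have mean := ball_avg_power_mean q.+2 aK.
  have B0 : 0 <= B by exact: section_avg_ge0.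
  rewrite (avg_section_star_body sK) (vol_star_body sK).
  rewrite (powRM _ (ltW V3) (ball_avg_ge0 (angularX q.+3 aK))).
  apply: (@le_trans _ _ (vol (@ball2 R q.+2) * (B * ball_avg (gauge_ratio (Defs.minkowski K))))).
    by rewrite (ler_pM2l V2).
  apply: (@le_trans _ _ (vol (@ball2 R q.+2) * (B * ball_avg
      (fun x => gauge_ratio (Defs.minkowski K) x ^+ q.+3) `^ q.+3%:R^-1))).
    by rewrite (ler_pM2l V2) (ler_wpM2l B0).
  (* The volume of the [n.-2]-ball cancels against the one in [M], and the root of the volume of the
     [n]-ball against the one in [vol K]. *)
  rewrite le_eqVlt; apply/orP; left; apply/eqP; rewrite /c /=.
  by field; rewrite !gt_eqF.
have gE := enorm_gauge (R := R) q.+3.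
have r1 k (x : 'rV[R]_q.+3) : x != 0 -> gauge_ratio (@enorm R q.+3) x ^+ k = 1.
  by move=> x0; rewrite /gauge_ratio divff ?expr1n// enorm_eq0.
(* Every central section of the ball has the same average section, namely the volume of a unit ball
   two dimensions lower. *)
exists (vol (@ball2 R q.+1)).
  have secE xi : sphere xi -> avg_section (hsection (@ball2 R q.+3) xi) = vol (@ball2 R q.+1).
    move=> xi1; rewrite (avg_section_hsection_gauge gE xi1).
    rewrite -[RHS]mulr1; congr (_ * _).
    rewrite -[RHS](@ball_avg_cst R q.+1 1 ler01); apply: eq_ball_avg => y y0.
    have [EE _] := perp_frameP xi1.
    by apply: r1; rewrite -enorm_gt0 enorm_isom// enorm_gt0.
  have a1 : angular (fun _ : 'rV[R]_q.+3 => 1 : R) by exact: angular_cst.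
  (* Used only to produce a unit vector. *)
  have [xi0 xi01 _] := section_avg_max a1.
  split; first by exists xi0; [exact: xi01|exact: secE].
  by move=> xi xi1; rewrite (secE _ xi1).
rewrite (avg_section_gauge gE).
rewrite (eq_ball_avg (k := fun=> 1)); last by move=> x; exact: r1.
rewrite (@ball_avg_cst R q.+2 1 ler01) /c /=.
by field; rewrite !gt_eqF.
Qed.
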